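(* The system $(\mathcal{H},T)$ is the universal minimal system with quasi-discrete spectrum; that is, $(\mathcal{H},T)$ is minimal and has quasi-discrete spectrum, and every minimal dynamical system with quasi-discrete spectrum is a factor of $(\mathcal{H},T)$.
   Context: A dynamical system is a pair $(X,s)$ with $X$ a compact Hausdorff space and $s:X\to X$ a homeomorphism; it is minimal if every orbit $\{s^nx:n\in\mathbb{Z}\}$ is dense. $(Y,t)$ is a factor of $(X,s)$ if there is a continuous surjection $\pi:X\to Y$ with $\pi\circ s=t\circ\pi$. $\mathbb{T}$ is the unit circle in $\mathbb{C}$; $\mathcal{C}(X)$ is the algebra of continuous complex functions on $X$ (supremum norm); $\mathcal{C}(X,\mathbb{T})$ the multiplicative group of continuous functions $X\to\mathbb{T}$; $s^*f=f\circ s$. Let $G_0(X,s)$ be the constant functions $X\to\mathbb{T}$, $G_{m+1}(X,s)=\{g\in\mathcal{C}(X,\mathbb{T}): s^*g=fg\text{ for some }f\in G_m(X,s)\}$, $G(X,s)=\bigcup_{m\ge0}G_m(X,s)$. $(X,s)$ has (topological) quasi-discrete spectrum if the linear span of $G(X,s)$ is dense in $\mathcal{C}(X)$. $\mathbb{N}=\{1,2,\ldots\}$, $\mathbb{Z}_+=\{0,1,\ldots\}$; $\mathbb{T}_Q=\{e^{i2\pi q}:q\in\mathbb{Q}\}$. $H(\mathbb{T})$ is the set of all (not necessarily continuous) group homomorphisms $\mathbb{T}\to\mathbb{T}$, with pointwise multiplication and the topology of pointwise convergence. $\phi^{(j)}$ denotes the $j$-fold composition of $\phi$ with itself; $s(k,j)$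 are the (signed) Stirling numbers of the first kind: $n(n-1)\cdots(n-k+1)=\sum_{j=0}^k s(k,j)n^j$. $\mathcal{H}$ is the set of all $(\phi_k)_{k=0}^\infty\in H(\mathbb{T})^{\mathbb{Z}_+}$ with $\phi_0=\mathrm{id}_{\mathbb{T}}$ and $\phi_k(x^{k!})=\prod_{j=1}^k\phi_1^{(j)}(x^{s(k,j)})$ for all $x\in\mathbb{T}_Q$, $k\in\mathbb{N}$, a compact space in the subspace topology of the product. $T:\mathcal{H}\to\mathcal{H}$ is the homeomorphism $T(\phi_0,\phi_1,\phi_2,\ldots)=(\phi_0,\phi_0\phi_1,\phi_1\phi_2,\ldots)$ (pointwise products). *)

(* Defs.v *)
From HB Require Import structures.
From mathcomp Require Import all_boot all_order all_algebra.
From mathcomp Require Import complex.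
From mathcomp Require Import all_classical all_reals all_analysis.

Set Implicit Arguments.
Unset Strict Implicit.
Unset Printing Implicit Defensive.

Import Order.TTheory GRing.Theory Num.Theory.
Import numFieldTopology.Exports numFieldNormedType.Exports.

Local Open Scope classical_set_scope.
Local Open Scope ring_scope.
Local Open Scope complex_scope.

(* The topology of R[i] given by its modulus. *)
HB.instance Definition _ (R : rcfType) := PseudoPointedMetric.copy R[i] R[i]^o.

Definition circle (R : realType) : Type := set_type [set z : R[i] | `|z| = 1].

HB.instance Definition _ (R : realType) :=
  Topological.copy (circle R) (set_type [set z : R[i] | `|z| = 1]).

Definition circle_val (R : realType) (x : circle R) : R[i] := set_val x.

Section CircleGroup.
Variable R : realType.
Implicit Types x y z : circle R.

Lemma circle_val_inj : injective (@circle_val R).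
Proof. by move=> x y; exact: val_inj. Qed.

Lemma norm_circle_val x : `|circle_val x| = 1.
Proof. exact: (set_valP x). Qed.

Fact circle_one_subproof : `|1 : R[i]| = 1.
Proof. exact: normr1. Qed.

Fact circle_mul_subproof x y : `|circle_val x * circle_val y| = 1.
Proof. by rewrite normrM !norm_circle_val mulr1. Qed.

Fact circle_inv_subproof x : `|(circle_val x)^-1| = 1.
Proof. by rewrite normfV norm_circle_val invr1. Qed.

Definition circle_one : circle R := exist _ 1 (mem_set circle_one_subproof).
Definition circle_mul x y : circle R :=
  exist _ (circle_val x * circle_val y) (mem_set (circle_mul_subproof x y)).
Definition circle_inv x : circle R :=
  exist _ (circle_val x)^-1 (mem_set (circle_inv_subproof x)).

Fact circle_mulA : associative circle_mul.
Proof. by move=> x y z; apply: circle_val_inj; exact: mulrA. Qed.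

Fact circle_mulC : commutative circle_mul.
Proof. by move=> x y; apply: circle_val_inj; exact: mulrC. Qed.

Fact circle_mul1 : left_id circle_one circle_mul.
Proof. by move=> x; apply: circle_val_inj; exact: mul1r. Qed.

Fact circle_mulr1 : right_id circle_one circle_mul.
Proof. by move=> x; rewrite circle_mulC circle_mul1. Qed.

Fact circle_mulV : left_inverse circle_one circle_inv circle_mul.
Proof.
move=> x; apply: circle_val_inj; apply: mulVf.
by rewrite -normr_eq0 norm_circle_val oner_neq0.
Qed.

Fact circle_mulrV : right_inverse circle_one circle_inv circle_mul.
Proof. by move=> x; rewrite circle_mulC circle_mulV. Qed.

End CircleGroup.

HB.instance Definition _ (R : realType) :=
  monoid.isGroup.Build (circle R) (@circle_mulA R) (@circle_mul1 R) (@circle_mulr1 R)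
    (@circle_mulV R) (@circle_mulrV R).

Lemma circle_mulgC (R : realType) (x y : circle R) : (x * y = y * x)%g.
Proof. exact: circle_mulC. Qed.

Lemma circle_mulACA (R : realType) (a b c d : circle R) :
  (a * b * (c * d) = a * c * (b * d))%g.
Proof. by rewrite -!mulgA; congr (_ * _)%g; rewrite !mulgA [(b * c)%g]circle_mulgC. Qed.

Definition expgz (G : groupType) (x : G) (n : int) : G :=
  match n with Posz m => x ^+ m | Negz m => x ^- m.+1 end%g.

(* The points exp (2 pi i q) with q rational. *)
Definition circleQ (R : realType) : set (circle R) :=
  [set x | exists q : rat,
     circle_val x = cos (2 * pi * ratr q) +i* sin (2 * pi * ratr q)].

Definition homeomorphism (X Y : topologicalType) (f : X -> Y) :=
  continuous f /\
  exists g : Y -> X, [/\ cancel f g, cancel g f & continuous g].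

(* As usual in topological dynamics, phase spaces are nonempty. *)
Definition dynamical_system (X : topologicalType) (s : X -> X) :=
  [/\ [set: X] !=set0, compact [set: X], hausdorff_space X & homeomorphism s].

(* As s is bijective, the condition iter n s y = x says that y is the image of
   x under the n-th power of the inverse of s. *)
Definition orbit (X : Type) (s : X -> X) (x : X) : set X :=
  [set y | exists n : nat, y = iter n s x \/ iter n s y = x].

Definition minimal (X : topologicalType) (s : X -> X) :=
  forall x : X, dense (orbit s x).

Definition is_factor (Y X : topologicalType) (t : Y -> Y) (s : X -> X) :=
  exists p : X -> Y,
    [/\ continuous p, (forall y, exists x, p x = y) & p \o s =1 t \o p].

Section QuasiDiscreteSpectrum.
Variables (R : realType) (X : topologicalType) (s : X -> X).

(* On a compact space the topology of uniform convergence is that of the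
   supremum norm. *)
Definition Cont : topologicalType :=
  set_type [set f : {uniform X -> R[i]} | continuous (f : X -> R[i])].

Fixpoint quasi_eigen (m : nat) : set (X -> circle R) :=
  match m with
  | 0%N => [set g | exists c, forall x, g x = c]
  | m'.+1 => [set g | continuous g /\
      exists2 f, quasi_eigen m' f & forall x, g (s x) = (f x * g x)%g]
  end.

Definition quasi_eigens : set (X -> circle R) := \bigcup_m quasi_eigen m.

Definition quasi_eigen_span : set Cont :=
  [set f | exists (n : nat) (c : 'I_n -> R[i]) (g : 'I_n -> X -> circle R),
     (forall i, quasi_eigens (g i)) /\
     (forall x, (set_val f : X -> R[i]) x =
                \sum_(i < n) c i * circle_val (g i x))].

Definition quasi_discrete_spectrum := dense quasi_eigen_span.

End QuasiDiscreteSpectrum.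

Definition falling (k : nat) : {poly int} := \prod_(i < k) ('X - (i%:Z)%:P).

(* Signed Stirling numbers of the first kind. *)
Definition stirling1 (k j : nat) : int := (falling k)`_j.

Section SequenceSpace.
Variable R : realType.

(* All endomorphisms of the circle group, continuous or not, with the topology
   of pointwise convergence. *)
Definition circle_end : topologicalType :=
  set_type [set f : {ptws circle R -> circle R} |
             {morph (f : circle R -> circle R) : x y / (x * y)%g}].

Definition end_fun (f : circle_end) : circle R -> circle R := set_val f.

Lemma end_funM (f : circle_end) : {morph end_fun f : x y / (x * y)%g}.
Proof. exact: (set_valP f). Qed.

Fact end_id_subproof :
  {morph (fun x : circle R => x) : x y / (x * y)%g}.
Proof. by []. Qed.

Fact end_mul_subproof (f g : circle_end) :
  {morph (fun x => end_fun f x * end_fun g x)%g : x y / (x * y)%g}.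
Proof. by move=> x y; rewrite !end_funM circle_mulACA. Qed.

Definition end_id : circle_end := exist _ (fun x => x) (mem_set end_id_subproof).

Definition end_mul (f g : circle_end) : circle_end :=
  exist _ (fun x => end_fun f x * end_fun g x)%g
    (mem_set (end_mul_subproof f g)).

Definition stirling_relations (phi : nat -> circle_end) :=
  phi 0%N = end_id /\
  forall k : nat, (0 < k)%N -> forall x : circle R, circleQ x ->
    end_fun (phi k) (x ^+ k`!)%g =
    (\prod_(1 <= j < k.+1)
       iter j (end_fun (phi 1%N)) (expgz x (stirling1 k j)))%g.

Definition calH : topologicalType :=
  set_type [set phi : prod_topology (fun _ : nat => circle_end) |
             stirling_relations phi].

Definition calH_seq (phi : calH) : nat -> circle_end := set_val phi.

Definition shift_seq (phi : nat -> circle_end) (k : nat) : circle_end :=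
  if k is k'.+1 then end_mul (phi k') (phi k) else phi 0%N.


(* The shift map preserves the Stirling relations.  For an endomorphism f of
   the circle and p : {poly int}, polyact f n p is the endomorphism p(f),
   computed with the first n coefficients of p. *)

Definition polyact (f : circle R -> circle R) (n : nat) (p : {poly int})
    (x : circle R) : circle R :=
  (\prod_(0 <= j < n) iter j f (expgz x p`_j))%g.

Lemma circle_valM (x y : circle R) :
  circle_val (x * y)%g = circle_val x * circle_val y.
Proof. by []. Qed.

Lemma circle_val_neq0 (x : circle R) : circle_val x != 0.
Proof. by rewrite -normr_eq0 norm_circle_val oner_neq0. Qed.

Lemma circle_valX (x : circle R) n :
  circle_val (x ^+ n)%g = circle_val x ^+ n.
Proof. by elim: n => // n IHn; rewrite expgS exprS circle_valM IHn. Qed.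

Lemma circle_valXz (x : circle R) (n : int) :
  circle_val (expgz x n) = circle_val x ^ n.
Proof.
case: n => n; first exact: circle_valX.
by rewrite -[RHS]/((circle_val x ^+ n.+1)^-1) -circle_valX.
Qed.

Lemma expgzD (x : circle R) (a b : int) :
  expgz x (a + b) = (expgz x a * expgz x b)%g.
Proof.
apply: circle_val_inj.
by rewrite circle_valM !circle_valXz expfzDr // circle_val_neq0.
Qed.

Lemma expgzM (x y : circle R) (a : int) :
  expgz (x * y)%g a = (expgz x a * expgz y a)%g.
Proof. by apply: circle_val_inj; rewrite circle_valM !circle_valXz expfzMl. Qed.

Lemma expgz0 (x : circle R) : expgz x 0 = 1%g. Proof. by []. Qed.

Section Polyact.
Variable f : circle R -> circle R.
Hypothesis fM : {morph f : x y / (x * y)%g}.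
Implicit Types (n m : nat) (p q : {poly int}) (x y : circle R).

Lemma circle_morph1 : f 1%g = 1%g.
Proof. by apply: (@mulgI _ (f 1%g)); rewrite -fM !mulg1. Qed.

Lemma circle_morphX n (x : circle R) : f (x ^+ n)%g = (f x ^+ n)%g.
Proof. by elim: n => [|n IHn]; rewrite ?circle_morph1 // !expgS fM IHn. Qed.

Lemma iter_morphM j : {morph iter j f : x y / (x * y)%g}.
Proof. by elim: j => // j IHj x y; rewrite !iterS IHj fM. Qed.

Lemma iter_morph1 j : iter j f 1%g = 1%g.
Proof. by elim: j => // j IHj; rewrite iterS IHj circle_morph1. Qed.

Lemma polyactSr n p x :
  polyact f n.+1 p x = (polyact f n p x * iter n f (expgz x p`_n))%g.
Proof. by rewrite /polyact big_nat_recr. Qed.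

Lemma polyact0n p x : polyact f 0 p x = 1%g.
Proof. by rewrite /polyact big_nil. Qed.

Lemma polyactD n p q x :
  polyact f n (p + q) x = (polyact f n p x * polyact f n q x)%g.
Proof.
elim: n => [|n IHn]; first by rewrite !polyact0n mulg1.
by rewrite !polyactSr IHn coefD expgzD iter_morphM circle_mulACA.
Qed.

Lemma polyactM n p x y :
  polyact f n p (x * y)%g = (polyact f n p x * polyact f n p y)%g.
Proof.
elim: n => [|n IHn]; first by rewrite !polyact0n mulg1.
by rewrite !polyactSr IHn expgzM iter_morphM circle_mulACA.
Qed.

Lemma polyact0 n x : polyact f n 0 x = 1%g.
Proof. by apply: (@mulgI _ (polyact f n 0 x)); rewrite -polyactD addr0 mulg1. Qed.

Lemma polyactMn n p m x : polyact f n (p *+ m) x = (polyact f n p x ^+ m)%g.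
Proof.
by elim: m => [|m IHm]; rewrite ?mulr0n ?polyact0 // mulrS polyactD IHm expgS.
Qed.

Lemma polyactX n p m x : polyact f n p (x ^+ m)%g = (polyact f n p x ^+ m)%g.
Proof.
elim: m => [|m IHm]; last by rewrite !expgS polyactM IHm.
by apply: (@mulgI _ (polyact f n p 1%g)); rewrite -polyactM !mulg1.
Qed.

Lemma polyactS n p x : (size p <= n)%N -> polyact f n.+1 p x = polyact f n p x.
Proof.
by move=> pn; rewrite polyactSr nth_default // expgz0 iter_morph1 mulg1.
Qed.

Lemma polyactC n c x : polyact f n.+1 c%:P x = expgz x c.
Proof.
elim: n => [|n IHn]; first by rewrite polyactSr polyact0n mul1g coefC.
have cn : (c%:P)`_n.+1 = 0 by rewrite coefC.
by rewrite polyactSr IHn cn expgz0 iter_morph1 mulg1.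
Qed.

Lemma polyact_mulX n p x : polyact f n.+1 (p * 'X) x = f (polyact f n p x).
Proof.
elim: n => [|n IHn].
  by rewrite polyactSr !polyact0n mul1g coefMX /= circle_morph1.
by rewrite polyactSr IHn polyactSr fM coefMX /=.
Qed.

End Polyact.

Lemma polyact_shift (f : circle R -> circle R) n (p : {poly int}) x :
  {morph f : x y / (x * y)%g} -> (size p <= n)%N ->
  polyact (fun y => y * f y)%g n p x = polyact f n (p \Po ('X + 1)) x.
Proof.
move=> fM; set g := fun y => (y * f y)%g.
have gM : {morph g : x y / (x * y)%g}.
  by move=> a b; rewrite /g fM circle_mulACA.
elim/poly_ind: p n => [|q c IHq] n; first by rewrite comp_poly0 !polyact0.
case: n => [|n] qn; first by rewrite !polyact0n.
have {qn}qn : (size q <= n)%N.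
  have [->|q0] := eqVneq q 0; first by rewrite size_poly0.
  by move: qn; rewrite size_MXaddC (negPf q0).
have q'n : (size (q \Po ('X + 1)) <= n)%N.
  rewrite -[X in _ \Po ('X + X)]polyC1 size_comp_poly2 ?size_XaddC //.
rewrite comp_polyD comp_polyC comp_polyM comp_polyX mulrDr mulr1.
rewrite !polyactD // !polyactC // !polyact_mulX // IHq // [g _]/g.
by rewrite (polyactS fM _ q'n) (circle_mulgC (f _)).
Qed.

Lemma size_falling k : size (falling k) = k.+1.
Proof.
by rewrite /falling size_prod_XsubC /index_enum -enumT size_enum_ord.
Qed.

Lemma fallingS k : falling k.+1 = falling k * ('X - (k%:Z)%:P).
Proof. by rewrite /falling big_ord_recr. Qed.

Lemma falling_shift k :
  falling k.+1 \Po ('X + 1) = falling k.+1 + falling k *+ k.+1.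
Proof.
suff -> : falling k.+1 \Po ('X + 1) = ('X + 1) * falling k.
  have kE : (k%:Z)%:P = k%:R :> {poly int} by rewrite -polyC_natr natz.
  by rewrite fallingS kE -(mulr_natr (falling k) k.+1) -mulrDr mulrC -addn1 natrD addrA subrK.
elim: k => [|k IHk].
  by rewrite fallingS /falling big_ord0 mul1r mulr1 comp_polyB comp_polyX
    comp_polyC subr0.
rewrite fallingS comp_polyM IHk comp_polyB comp_polyX comp_polyC fallingS -mulrA.
congr (_ * (_ * _)).
by rewrite -[k.+1]add1n PoszD polyCD opprD addrA addrK.
Qed.

Lemma stirling_prodE (f : circle R -> circle R) k x :
  {morph f : x y / (x * y)%g} -> (0 < k)%N ->
  (\prod_(1 <= j < k.+1) iter j f (expgz x (stirling1 k j)))%g =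
  polyact f k.+1 (falling k) x.
Proof.
move=> fM k0; rewrite /polyact [RHS]big_nat_recl //.
suff -> : (falling k)`_0 = 0.
  by rewrite expgz0 iter_morph1 // mul1g big_add1.
rewrite -horner_coef0 /falling horner_prod; apply/eqP/prodf_eq0.
by exists (Ordinal k0) => //; rewrite hornerXsubC subr0.
Qed.

Fact shift_stirling (phi : nat -> circle_end) :
  stirling_relations phi -> stirling_relations (shift_seq phi).
Proof.
move=> [phi0 phiP]; split=> // k; case: k => // k _ x xQ.
set f := end_fun (phi 1%N).
have fM : {morph f : x y / (x * y)%g} by exact: end_funM.
have E m : end_fun (phi m) (x ^+ m`!)%g = polyact f m.+1 (falling m) x.
  case: m => [|m]; last by rewrite phiP // stirling_prodE.
  rewrite phi0 fact0 expg1 /falling big_ord0 -polyC1 polyactC //.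
have gE : end_fun (shift_seq phi 1%N) = (fun y => y * f y)%g.
  by rewrite /shift_seq phi0.
rewrite stirling_prodE ?gE //; last by move=> a b; rewrite fM circle_mulACA.
rewrite polyact_shift ?size_falling // falling_shift polyactD // polyactMn //.
rewrite -E (polyactS fM) ?size_falling // -E -circle_morphX; last exact: end_funM.
by rewrite -expgnA mulnC -factS circle_mulgC.
Qed.

Definition calT (phi : calH) : calH :=
  exist _ (shift_seq (calH_seq phi))
    (mem_set (shift_stirling (set_valP phi))).

End SequenceSpace.

(* Main.v *)
(* For phi in H put e_{k,x} phi = phi_k x.  Then e_{k+1,x} o T = e_{k,x} e_{k+1,x}
   and e_{0,x} is constant, so finite products of the e_{k,x} are quasi-eigenfunctions;
   they separate points, hence have dense span by Stone-Weierstrass.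

   Minimality.  A product of the e_{k,x} in which some x with k >= 1 has infinite
   order has uniform averages tending to 0, by van der Corput differencing.  Hence
   averaging does not see translations of H by sequences of homomorphisms trivial on
   roots of unity.  Modulo such translations, a point of H is determined by the
   restriction of phi_1 to roots of unity, which the shift translates transitively,
   as an odometer.  So no orbit can miss an open set.

   Universality.  Let J be the orbit closure of a point (h, x) in H x X.  If
   s^* g = f g and f agrees on J with a product of e_{k,x_k}, then g agrees on J, up
   to a constant, with the product of the e_{k+1,x_k}.  So quasi-eigenfunctions of X
   factor through H on J; as they separate points, J is the graph of a map H -> X. *)

Require Import Defs.
From mathcomp Require Import all_boot all_order all_algebra.
From mathcomp Require Import complex ring lra.
From mathcomp Require Import all_classical all_reals all_analysis.

Set Implicit Arguments.
Unset Strict Implicit.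
Unset Printing Implicit Defensive.

Import Order.TTheory GRing.Theory Num.Theory.
Import numFieldTopology.Exports numFieldNormedType.Exports.

Local Open Scope classical_set_scope.
Local Open Scope ring_scope.
Local Open Scope complex_scope.

Local Notation Re := (@complex.Re _).
Local Notation Im := (@complex.Im _).

(** * Topology of the circle *)

Lemma initial_cvg (S : choiceType) (T : topologicalType) (f : S -> T)
    (F : set_system S) (s : S) :
  Filter F -> f @ F --> f s -> F --> (s : initial_topology f).
Proof.
move=> FF Ff A [_ [[B oB <-] Bs] BA].
rewrite nbhs_filterE; apply: filterS BA _.
by apply: Ff; exact: open_nbhs_nbhs.
Qed.

Lemma set_type_cvg (X : topologicalType) (A : set X)
    (F : set_system (set_type A)) (p : set_type A) :
  Filter F -> set_val @ F --> set_val p -> F --> p.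
Proof. by move=> FF Fp; exact: initial_cvg. Qed.

Lemma continuous_set_val (X : topologicalType) (A : set X) :
  continuous (set_val : set_type A -> X).
Proof. exact: initial_continuous. Qed.

Lemma continuous_set_type (Y X : topologicalType) (A : set X)
    (f : Y -> set_type A) :
  continuous (set_val \o f) -> continuous f.
Proof.
move=> cf y.
have FF : Filter (f @ y) by apply: fmap_filter; exact: nbhs_filter.
by apply: set_type_cvg; exact: cf.
Qed.

Lemma prod_topology_cvg (I : eqType) (T : I -> topologicalType)
    (F : set_system (prod_topology T)) (p : prod_topology T) :
  Filter F -> (forall i, (fun f => f i) @ F --> p i) -> F --> p.
Proof.
by move=> FF Fp; apply/cvg_sup => i; apply: initial_cvg; exact: Fp.
Qed.

(** A cluster point of an image ultrafilter is a limit: if the preimage of a neighbourhood [A] were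
    not in [F], its complement would be, and clustering would give a point both in and outside
    [A]. *)
Lemma ultra_compact_cvg (X : choiceType) (Y : topologicalType) (K : set Y)
    (f : X -> Y) (F : set_system X) :
  compact K -> UltraFilter F -> F (f @^-1` K) -> exists2 y, K y & f @ F --> y.
Proof.
move=> cK FU FK; have [y [Ky yF]] := cK _ (fmap_proper_filter f _) FK.
exists y => // A Ay; have [//|FnA] := in_ultra_setVsetC (f @^-1` A) FU.
by have [z [nAz Az]] := yF (~` A) A FnA Ay.
Qed.

(** If all neighbourhoods of [p] and [q] meet, the same holds for their images under a continuous
    map, so no map into a Hausdorff space tells them apart. *)
Lemma continuous_comp_hausdorff (X : topologicalType) :
  (forall p q : X, (forall (Y : topologicalType) (f : X -> Y),
      hausdorff_space Y -> continuous f -> f p = f q) -> p = q) ->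
  hausdorff_space X.
Proof.
move=> sepX p q pq; apply: sepX => Y f hY cf; apply: hY => A B Ap Bq.
have [x [Ax Bx]] := pq _ _ (cf _ _ Ap) (cf _ _ Bq).
by exists (f x).
Qed.

Section ComplexTopology.
Variable R : realType.
Implicit Types z : R[i].

Lemma ler_normRe z : (`|Re z|)%:C <= `|z|.
Proof. exact: normc_ge_Re. Qed.

Lemma ler_normIm z : (`|Im z|)%:C <= `|z|.
Proof.
have := ler_normRe (z * 'i); rewrite ReiNIm normrN => /le_trans -> //.
by rewrite normrM normCi mulr1.
Qed.

Lemma ReM (z w : R[i]) : Re (z * w) = Re z * Re w - Im z * Im w.
Proof. by case: z; case: w. Qed.

Lemma ImM (z w : R[i]) : Im (z * w) = Re z * Im w + Im z * Re w.
Proof. by case: z; case: w. Qed.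

Lemma norm_real_complex (r : R) : `|r%:C| = `|r|%:C.
Proof. by rewrite normc_def /= expr0n addr0 sqrtr_sqr. Qed.

(** In the partial order of [R[i]] only reals are positive; this turns complex error bounds into
    real ones. *)
Lemma gt0_complexE z : 0 < z -> z = (Re z)%:C.
Proof. by rewrite ltcE => /andP[/eqP]; case: z => a b /= ->. Qed.

Lemma continuous_Re : continuous (@complex.Re R : R[i] -> R).
Proof.
move=> z A /nbhs_ballP[e e0 eA]; apply/nbhs_ballP.
exists e%:C => [|w zw]; first by rewrite /= ltcR.
apply: eA; rewrite -ball_normE /=.
rewrite -raddfB -ltcR; exact: le_lt_trans (ler_normRe _) zw.
Qed.

Lemma continuous_Im : continuous (@complex.Im R : R[i] -> R).
Proof.
move=> z A /nbhs_ballP[e e0 eA]; apply/nbhs_ballP.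
exists e%:C => [|w zw]; first by rewrite /= ltcR.
apply: eA; rewrite -ball_normE /=.
rewrite -raddfB -ltcR; exact: le_lt_trans (ler_normIm _) zw.
Qed.

Lemma complex_cvg (T : Type) (F : set_system T) (f : T -> R[i]) z :
  Filter F -> Re \o f @ F --> Re z -> Im \o f @ F --> Im z -> f @ F --> z.
Proof.
move=> FF /cvgrPdist_lt cR /cvgrPdist_lt cI A /nbhs_ballP [e e0 eA].
have {}e0 : 0 < e := e0.
have eE := gt0_complexE e0.
have e20 : 0 < Re e / 2 by rewrite divr_gt0 // -ltcR -eE.
have H1 := cR _ e20; have H2 := cI _ e20.
rewrite /= nbhs_simpl /=; near=> t; apply: eA.
suff : `|z - f t| < e by [].
rewrite eE.
rewrite (complexE (z - f t)).
apply: (le_lt_trans (ler_normD _ _)).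
rewrite normrM complexiE normCi mul1r.
have -> : (Re e)%:C = (Re e / 2)%:C + (Re e / 2)%:C by rewrite -raddfD /= -splitr.
rewrite !norm_real_complex !raddfB; apply: ltrD; rewrite ltcR; near: t;
  [exact: H1|exact: H2].
Unshelve. all: by end_near. Qed.

Lemma continuous_complexP (X : topologicalType) (f : X -> R[i]) :
  continuous f <-> continuous (Re \o f) /\ continuous (Im \o f).
Proof.
split=> [cf|[cR cI] x]; last by apply: complex_cvg; [exact: cR|exact: cI].
split=> x; apply: continuous_comp; [exact: cf|exact: continuous_Re|exact: cf|].
exact: continuous_Im.
Qed.

Lemma hausdorff_complex : hausdorff_space R[i].
Proof.
apply: continuous_comp_hausdorff => -[a b] [c d] E.
have hR : hausdorff_space R by exact: norm_hausdorff.
have /= -> := E R (@complex.Re R) hR continuous_Re.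
by have /= -> := E R (@complex.Im R) hR continuous_Im.
Qed.

End ComplexTopology.

Section CircleTopology.
Variable R : realType.

Lemma continuous_circle_val : continuous (@circle_val R).
Proof. exact: continuous_set_val. Qed.

Lemma circle_cvg (T : Type) (F : set_system T) (f : T -> circle R) x :
  Filter F -> (@circle_val R) \o f @ F --> circle_val x -> f @ F --> x.
Proof. by move=> FF Ff; apply: set_type_cvg. Qed.

Lemma continuous_circleP (X : topologicalType) (f : X -> circle R) :
  continuous f <-> continuous (@circle_val R \o f).
Proof.
split=> [cf x|]; last exact: continuous_set_type.
by apply: continuous_comp; [exact: cf|exact: continuous_circle_val].
Qed.

Lemma hausdorff_circle : hausdorff_space (circle R).
Proof.
apply: continuous_comp_hausdorff => x y E; apply: circle_val_inj.
apply: E; [exact: hausdorff_complex|exact: continuous_circle_val].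
Qed.

Lemma circle_sqr (x : circle R) :
  Re (circle_val x) ^+ 2 + Im (circle_val x) ^+ 2 = 1.
Proof.
by apply: complexI; rewrite add_Re2_Im2 norm_circle_val expr1n.
Qed.

Lemma circle_Re_bound (x : circle R) : -1 <= Re (circle_val x) <= 1.
Proof.
rewrite -ler_norml -lecR; apply: le_trans (ler_normRe _) _.
by rewrite norm_circle_val.
Qed.

Lemma circle_Im_bound (x : circle R) : -1 <= Im (circle_val x) <= 1.
Proof.
rewrite -ler_norml -lecR; apply: le_trans (ler_normIm _) _.
by rewrite norm_circle_val.
Qed.

Lemma circle_valV (x : circle R) :
  circle_val (x^-1)%g = (circle_val x)^*%C.
Proof.
rewrite -[LHS]/((circle_val x)^-1) invc_norm norm_circle_val.
by rewrite expr1n invr1 mul1r.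
Qed.

Lemma continuous_circleM (X : topologicalType) (f g : X -> circle R) :
  continuous f -> continuous g -> continuous (fun x => f x * g x)%g.
Proof.
move=> /continuous_circleP/continuous_complexP[f1 f2].
move=> /continuous_circleP/continuous_complexP[g1 g2].
apply/continuous_circleP/continuous_complexP; split=> x /=.
- rewrite (_ : _ \o _ = (Re \o (@circle_val R \o f)) \* (Re \o (@circle_val R \o g))
    \- (Im \o (@circle_val R \o f)) \* (Im \o (@circle_val R \o g))).
    by apply: cvgB; apply: cvgM; [exact: f1|exact: g1|exact: f2|exact: g2].
  by apply/funext => y /=; rewrite circle_valM ReM.
- rewrite (_ : _ \o _ = (Re \o (@circle_val R \o f)) \* (Im \o (@circle_val R \o g))
    \+ (Im \o (@circle_val R \o f)) \* (Re \o (@circle_val R \o g))).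
    by apply: cvgD; apply: cvgM; [exact: f1|exact: g2|exact: f2|exact: g1].
  by apply/funext => y /=; rewrite circle_valM ImM.
Qed.

Lemma continuous_circleV (X : topologicalType) (f : X -> circle R) :
  continuous f -> continuous (fun x => (f x)^-1)%g.
Proof.
move=> /continuous_circleP/continuous_complexP[f1 f2].
apply/continuous_circleP/continuous_complexP; split=> x /=.
- rewrite (_ : _ \o _ = Re \o (@circle_val R \o f)); first exact: f1.
  by apply/funext => y /=; rewrite circle_valV; case: (circle_val (f y)) => a b.
- rewrite (_ : _ \o _ = \- (Im \o (@circle_val R \o f))).
    by apply: cvgN; exact: f2.
  by apply/funext => y /=; rewrite circle_valV; case: (circle_val (f y)) => a b.
Qed.

(** Along an ultrafilter the real and imaginary parts converge in [-1, 1], and the relation a^2 +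
    b^2 = 1 passes to the limits. *)
Lemma compact_circle : compact [set: circle R].
Proof.
rewrite compact_ultra => F FU _.
have cI : compact `[(-1 : R), 1] by exact: segment_compact.
have [a _ Ra] : exists2 a, [set` `[(-1 : R), 1]] a & Re \o (@circle_val R) @ F
  --> a.
  apply: ultra_compact_cvg => //.
  by apply: filterE => x /=; rewrite in_itv /= circle_Re_bound.
have [b _ Ib] : exists2 b, [set` `[(-1 : R), 1]] b & Im \o (@circle_val R) @ F
  --> b.
  apply: ultra_compact_cvg => //.
  by apply: filterE => x /=; rewrite in_itv /= circle_Im_bound.
have ab1 : a ^+ 2 + b ^+ 2 = 1.
  have L : (fun x => Re (circle_val x) ^+ 2 + Im (circle_val x) ^+ 2) @ F -->
      a ^+ 2 + b ^+ 2.
    by apply: cvgD; rewrite expr2; under eq_fun do rewrite expr2; exact: cvgM.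
  move: L; under eq_fun do rewrite circle_sqr.
  have hR : hausdorff_space R by exact: norm_hausdorff.
  move=> L; apply: (cvg_unique hR L); exact: cvg_cst.
have nab : `|a +i* b| = 1 by rewrite normc_def /= ab1 sqrtr1.
exists (exist _ (a +i* b) (mem_set nab) : circle R); split=> //.
apply: (@circle_cvg _ F id); exact: (@complex_cvg R _ F (@circle_val R) (a +i* b)).
Qed.

End CircleTopology.

(** * Roots of unity *)

Lemma closed_equalizer (X Y : topologicalType) (f g : X -> Y) :
  hausdorff_space Y -> continuous f -> continuous g ->
  closed [set x | f x = g x].
Proof.
move=> hY cf cg p clp; apply: hY => A B Afp Bgp.
have nA : nbhs p ((f @^-1` A) `&` (g @^-1` B)).
  by apply: filterI; [exact: cf|exact: cg].
by have [x [/= fg [Afx Bgx]]] := clp _ nA; exists (f x); rewrite /= {2}fg.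
Qed.

Section Torsion.
Variable R : realType.
Implicit Types x y : circle R.

Fact circle_exp_subproof (t : R) : `|cos t +i* sin t| = 1 :> R[i].
Proof. by rewrite normc_def /= cos2Dsin2 sqrtr1. Qed.

Definition circle_exp (t : R) : circle R :=
  exist _ (cos t +i* sin t) (mem_set (circle_exp_subproof t)).

Lemma circle_val_exp t : circle_val (circle_exp t) = cos t +i* sin t.
Proof. by []. Qed.

Lemma circle_expD t u :
  circle_exp (t + u) = (circle_exp t * circle_exp u)%g.
Proof.
apply: circle_val_inj; rewrite circle_valM !circle_val_exp cosD sinD.
by congr (_ +i* _); rewrite addrC mulrC [X in _ + X]mulrC.
Qed.

Lemma circle_exp0 : circle_exp 0 = 1%g.
Proof. by apply: circle_val_inj; rewrite circle_val_exp cos0 sin0. Qed.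

Lemma circle_expMn t n : (circle_exp t ^+ n)%g = circle_exp (t *+ n).
Proof.
elim: n => [|n IHn]; first by rewrite circle_exp0.
by rewrite expgS IHn mulrS circle_expD.
Qed.

Lemma circle_exp2pi : circle_exp (2 * pi) = 1%g.
Proof.
apply: circle_val_inj; rewrite circle_val_exp mulr_natl.
by rewrite cos2pi sin2pi.
Qed.

Lemma circle_expN t : circle_exp (- t) = ((circle_exp t)^-1)%g.
Proof.
by apply: (@mulgI _ (circle_exp t)); rewrite -circle_expD subrr circle_exp0 mulgV.
Qed.

(** Here cos t = 1 - 2 sin^2 (t/2) < 1, because t/2 lies strictly between 0 and pi. *)
Lemma circle_exp_eq1 t : 0 < t < 2 * pi -> circle_exp t <> 1%g.
Proof.
move=> /andP[t0 t2] /(congr1 (fun x => Re (circle_val x))).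
rewrite circle_val_exp /= => c1.
have st : 0 < sin (t / 2) by apply: sin_gt0_pi; lra.
have : cos t = 1 - sin (t / 2) ^+ 2 *+ 2.
  by rewrite [in LHS](splitr t) -mulr2n cos_mulr2n cos2sin2; ring.
by rewrite c1; have := exprn_gt0 2 st; lra.
Qed.

Definition zeta (N : nat) : circle R := circle_exp (2 * pi / N%:R).

Lemma zeta_order N : (0 < N)%N -> (zeta N ^+ N)%g = 1%g.
Proof.
move=> N0; rewrite /zeta circle_expMn -[X in circle_exp X]mulr_natr divfK
  ?circle_exp2pi //.
by rewrite pnatr_eq0 -lt0n.
Qed.

(** The order m of [zeta N] divides N; if m < N, the angle 2 pi m / N lies strictly between 0 and 2
    pi, where the exponential is not 1. *)
Lemma zeta_prim N : (0 < N)%N -> N.-primitive_root (circle_val (zeta N)).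
Proof.
move=> N0; have zN : circle_val (zeta N) ^+ N = 1.
  by rewrite -circle_valX zeta_order.
have [m mP mN] := prim_order_exists N0 zN.
suff E : m = N by rewrite -{1}E.
have m0 := prim_order_gt0 mP.
apply/eqP; rewrite eqn_leq (dvdn_leq N0 mN) /= leqNgt; apply/negP => mltN.
have : (zeta N ^+ m)%g = 1%g.
  by apply: circle_val_inj; rewrite circle_valX (prim_expr_order mP).
rewrite /zeta circle_expMn; apply: circle_exp_eq1.
have N0' : 0 < (N%:R : R) by rewrite ltr0n.
have -> : 2 * pi / N%:R *+ m = 2 * pi * (m%:R / N%:R) :> R.
  by rewrite -[LHS]mulr_natr -!mulrA (mulrC _ m%:R).
have pi0 := pi_gt0 R.
apply/andP; split; first by rewrite !mulr_gt0 ?invr_gt0 ?ltr0n.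
rewrite gtr_pMr ?mulr_gt0 //.
by rewrite ltr_pdivrMr // mul1r ltr_nat.
Qed.

Lemma root_of_unity_zeta N x : (0 < N)%N -> (x ^+ N)%g = 1%g ->
  exists i, x = (zeta N ^+ i)%g.
Proof.
move=> N0 xN; have [|i xi] := prim_rootP (zeta_prim N0) (_ : circle_val x ^+ N = 1).
  by rewrite -circle_valX xN.
by exists i; apply: circle_val_inj; rewrite circle_valX.
Qed.

Definition torsion : set (circle R) :=
  [set x | exists2 N, (0 < N)%N & (x ^+ N)%g = 1%g].

Lemma circle_expQ (q : rat) : circleQ (circle_exp (2 * pi * ratr q)).
Proof. by exists q. Qed.

Lemma circleQ_torsion x : circleQ x -> torsion x.
Proof.
move=> [q xq].
have -> : x = circle_exp (2 * pi * ratr q) by exact: circle_val_inj.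
have d0 : (0 < `|denq q|)%N by rewrite absz_gt0 denq_neq0.
exists `|denq q|%N => //; rewrite circle_expMn.
have -> : (2 * pi * ratr q) *+ `|denq q| = 2 * pi * (numq q)%:~R :> R.
  have dq : (`|denq q|%N%:R : R) = (denq q)%:~R by rewrite -absz_denq.
  by rewrite -[LHS]mulr_natr dq -mulrA divfK // intr_eq0 denq_neq0.
case: (numq q) => n.
  by rewrite mulr_natr -circle_expMn circle_exp2pi expg1n.
by rewrite NegzE mulrNz mulrN circle_expN mulr_natr -circle_expMn circle_exp2pi
  expg1n invg1.
Qed.

(** Divisibility of the group of roots of unity. With m = k!, it lets the Stirling relations
    determine phi_k at every root of unity. *)
Lemma torsion_root m y : (0 < m)%N -> torsion y ->
  exists2 x, circleQ x & (x ^+ m)%g = y.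
Proof.
move=> m0 [N N0 /(root_of_unity_zeta N0)[i ->]].
exists (circle_exp (2 * pi * ratr (i%:R / (N * m)%N%:R))); first exact: circle_expQ.
rewrite /zeta !circle_expMn; congr circle_exp.
rewrite rmorphM fmorphV !rmorph_nat -[LHS]mulr_natr -[RHS]mulr_natr natrM.
by field; rewrite !pnatr_eq0 -!lt0n N0.
Qed.

Lemma finite_roots_of_unity N : (0 < N)%N ->
  finite_set [set x : circle R | (x ^+ N)%g = 1%g].
Proof.
move=> N0.
apply: (@sub_finite_set _ _ [set (zeta N ^+ i)%g | i in `I_N]).
  move=> x /= xN; have [|[i iN] xi] := prim_rootP (zeta_prim N0) (_ :
    circle_val x ^+ N = 1).
    by rewrite -circle_valX xN.
  by exists i => //; apply: circle_val_inj; rewrite circle_valX.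
exact/finite_image/finite_II.
Qed.

Lemma torsionX x n : torsion x -> torsion (x ^+ n)%g.
Proof.
by move=> [N N0 xN]; exists N => //; rewrite -expgnA mulnC expgnA xN expg1n.
Qed.

End Torsion.

(** * The sequence space *)

Section SequenceSpaceTopology.
Variable R : realType.
Local Notation H := (calH R).
Implicit Types (x y : circle R) (phi psi : H) (k : nat).

(** The evaluation e_{k,x}; the topology of H is the initial one for these maps. *)
Definition coord k x phi : circle R := end_fun (calH_seq phi k) x.

Lemma coordM k x y phi : (coord k (x * y) phi = coord k x phi * coord k y phi)%g.
Proof. exact: end_funM. Qed.

Lemma coord_morph k phi : {morph (coord k)^~ phi : x y / (x * y)%g}.
Proof. by move=> x y; exact: coordM. Qed.

Lemma calH_stirling phi : stirling_relations (calH_seq phi).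
Proof. exact: (set_valP phi). Qed.

Lemma coord0 x phi : coord 0 x phi = x.
Proof. by rewrite /coord (calH_stirling phi).1. Qed.

(** The Stirling relation in the form phi_k(x^{k!}) = p(phi_1)(x), with p the falling factorial;
    written this way it also covers k = 0, where both sides are x. *)
Lemma coord_stirling k x phi : circleQ x ->
  coord k (x ^+ k`!)%g phi = polyact ((coord 1)^~ phi) k.+1 (falling k) x.
Proof.
move=> xQ; case: k => [|k].
  by rewrite coord0 fact0 expg1 /falling big_ord0 -polyC1 polyactC //;
    exact: coord_morph.
by rewrite -stirling_prodE //; [apply: (calH_stirling phi).2|exact: coord_morph].
Qed.

Lemma circle_endP (f g : circle_end R) : end_fun f =1 end_fun g -> f = g.
Proof. by move=> fg; apply: val_inj; apply/funext. Qed.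

Lemma calH_ext phi psi : (forall k x, coord k x phi = coord k x psi) -> phi = psi.
Proof.
move=> E; apply: val_inj; apply/funext => k; apply: circle_endP => x.
exact: E.
Qed.

Lemma continuous_coord k x : continuous (coord k x).
Proof.
move=> phi.
apply: (@continuous_comp _ _ _ (fun phi => calH_seq phi k)
          (fun f : circle_end R => end_fun f x)).
  apply: (@continuous_comp _ _ _ (set_val : H -> _) (proj k)).
    exact: continuous_set_val.
  exact: proj_continuous.
apply: (@continuous_comp _ _ _
  (set_val : circle_end R -> {ptws circle R -> circle R}) (proj x)).
  exact: continuous_set_val.
exact: proj_continuous.
Qed.

Lemma calH_cvg (F : set_system H) phi : Filter F ->
  (forall k x, coord k x @ F --> coord k x phi) -> F --> phi.
Proof.
move=> FF Fphi; apply: set_type_cvg; apply: prod_topology_cvg => k.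
apply: set_type_cvg; apply: prod_topology_cvg => x; exact: Fphi.
Qed.

Lemma continuous_calH (X : topologicalType) (f : X -> H) :
  (forall k x, continuous (coord k x \o f)) -> continuous f.
Proof.
by move=> cf y; apply: calH_cvg => k x; exact: cf.
Qed.

Lemma hausdorff_calH : hausdorff_space H.
Proof.
apply: continuous_comp_hausdorff => phi psi E; apply: calH_ext => k x.
by apply: E; [exact: hausdorff_circle|exact: continuous_coord].
Qed.

Definition mk_end (f : circle R -> circle R)
  (fM : {morph f : x y / (x * y)%g}) : circle_end R := exist _ f (mem_set fM).

(* Iterates of coordinate 1 are not pointwise continuous, but on roots of unity a
   convergent filter is eventually constant, so the relations pass to limits. *)
Lemma cvg_root_of_unity (T : Type) (F : set_system T) (f : T -> circle R) N y :
  ProperFilter F -> (0 < N)%N -> (forall t, (f t ^+ N)%g = 1%g) -> f @ F --> y ->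
  F [set t | f t = y].
Proof.
move=> FF N0 fN Fy.
(* The N-th roots of unity other than [y] form a finite, hence closed set; its complement is a
   neighbourhood of [y]. *)
have cl : closed ([set x : circle R | (x ^+ N)%g = 1%g] `\ y).
  apply: (iffLR accessible_finite_set_closed).
    exact/hausdorff_accessible/hausdorff_circle.
  exact/finite_setD/finite_roots_of_unity.
have nb : nbhs y (~` ([set x : circle R | (x ^+ N)%g = 1%g] `\ y)).
  by apply: open_nbhs_nbhs; split; [exact: closed_openC|move=> [_]; exact].
have := Fy _ nb; rewrite nbhs_simpl /=; apply: filterS => t nt.
by apply: contrapT => fty; apply: nt; split=> //=; exact: fN.
Qed.

Lemma morph_root_of_unity (f : circle R -> circle R) N x :
  {morph f : x y / (x * y)%g} -> (x ^+ N)%g = 1%g -> (f x ^+ N)%g = 1%g.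
Proof. by move=> fM xN; rewrite -circle_morphX // xN circle_morph1. Qed.

(** Powers of x and their images under iterates of f remain N-th roots of unity, so p(f)(x) depends
    only on f at those roots. *)
Lemma polyact_agree (f g : circle R -> circle R) N n p x :
  {morph f : x y / (x * y)%g} -> (x ^+ N)%g = 1%g ->
  (forall y, (y ^+ N)%g = 1%g -> f y = g y) ->
  polyact f n p x = polyact g n p x.
Proof.
move=> fM xN fg; rewrite /polyact; apply: eq_bigr => j _.
have : (expgz x p`_j ^+ N)%g = 1%g.
  have xm m : ((x ^+ m) ^+ N)%g = 1%g by rewrite -expgnA mulnC expgnA xN expg1n.
  case: p`_j => m; first exact: xm.
  by rewrite -[expgz _ _]/((x ^+ m.+1)^-1)%g expVgn xm invg1.
elim: j (expgz x p`_j) => // j IHj y yN.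
by rewrite !iterSr -fg // IHj //; exact: morph_root_of_unity.
Qed.

Lemma circle_cvgM (T : Type) (F : set_system T) (f g : T -> circle R) x y :
  Filter F -> f @ F --> x -> g @ F --> y ->
    (fun t => f t * g t)%g @ F --> (x * y)%g.
Proof.
move=> FF Ff Fg.
have cM : continuous (fun z : circle R * circle R => z.1 * z.2)%g.
  by apply: continuous_circleM; move=> z; [exact: cvg_fst|exact: cvg_snd].
apply: (@cvg_comp _ _ _ (fun t => (f t, g t)) (fun z => z.1 * z.2)%g F _ _ _
  (cM (x, y))).
exact: (cvg_pair Ff Fg).
Qed.

Definition mk_calH (phi : nat -> circle_end R)
  (phiP : stirling_relations phi) : H := exist _ phi (mem_set phiP).

(** Along an ultrafilter every coordinate converges, by compactness of the circle, and the limits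
    are again homomorphisms. The Stirling relations survive because phi_1 is eventually constant on
    the roots of unity of a given order. *)
Lemma compact_calH : compact [set: H].
Proof.
rewrite compact_ultra => F FU _.
have lim_ex : forall kx : nat * circle R,
    exists l : circle R, coord kx.1 kx.2 @ F --> l.
  move=> kx; have [l _ ?] := ultra_compact_cvg (@compact_circle R) FU
    (filterT : F (coord kx.1 kx.2 @^-1` setT)).
  by exists l.
have [L LP] := boolp.choice lim_ex.
have LM k : {morph (fun x => L (k, x)) : x y / (x * y)%g}.
  move=> x y.
  apply: (cvg_unique (@hausdorff_circle R) (LP (k, (x * y)%g))).
  rewrite (_ : coord k _ = fun phi => coord k x phi * coord k y phi)%g.
    exact: circle_cvgM (LP (k, x)) (LP (k, y)).
  by apply/funext => phi; exact: coordM.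
pose l k := mk_end (LM k).
have lS : stirling_relations l.
  split=> [|k k0 x xQ].
    apply: circle_endP => x;
      apply: (cvg_unique (@hausdorff_circle R) (LP (0%N, x))).
    rewrite (_ : coord 0 x = cst x); first exact: cvg_cst.
    by apply/funext => phi; rewrite coord0.
  have [N N0 xN] := circleQ_torsion xQ.
  apply: (cvg_unique (@hausdorff_circle R) (LP (k, (x ^+ k`!)%g))).
  (* The value at the primitive root [zeta R N] fixes phi_1 on all N-th roots of unity, so
     stabilising this single coordinate is enough. *)
  have Fz : F [set phi | coord 1 (zeta R N) phi = L (1%N, zeta R N)].
    apply: (@cvg_root_of_unity _ _ _ N) => // [phi|]; last exact: LP.
    by apply: morph_root_of_unity; [exact: coord_morph|exact: zeta_order].
  rewrite stirling_prodE //; last exact: LM.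
  rewrite /=; apply: cvg_near_cst; apply: filterS Fz => phi phiz.
  rewrite coord_stirling //; apply: polyact_agree xN _; first exact: coord_morph.
  move=> y /(root_of_unity_zeta N0)[i ->].
  have /= -> := circle_morphX (@coord_morph 1 phi) i (zeta R N).
  by rewrite (circle_morphX (end_funM (l 1%N))) phiz.
exists (mk_calH lS); split=> //; apply: calH_cvg => k x; exact: (LP (k, x)).
Qed.

End SequenceSpaceTopology.

(** * The shift as a homeomorphism of the sequence space *)

Section ShiftDynamics.
Variable R : realType.
Local Notation H := (calH R).
Local Notation T := (@calT R).
Implicit Types (x y : circle R) (phi psi : H) (k : nat).

Lemma coordS_T k x phi : (coord k.+1 x (T phi) =
  coord k x phi * coord k.+1 x phi)%g.
Proof. by []. Qed.

Lemma continuous_T : continuous T.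
Proof.
apply: continuous_calH => -[|k] x.
  rewrite (_ : _ \o _ = coord 0 x); first exact: continuous_coord.
  by apply/funext => phi /=; rewrite !coord0.
rewrite (_ : _ \o _ = fun phi => coord k x phi * coord k.+1 x phi)%g //.
by apply: continuous_circleM; exact: continuous_coord.
Qed.

Lemma continuous_iter_T n : continuous (iter n T).
Proof.
elim: n => [|n IHn] phi; first exact: cvg_id.
by apply: continuous_comp; [exact: IHn|exact: continuous_T].
Qed.

Fact inv_end_subproof (f g : circle_end R) :
  {morph (fun x => (end_fun f x)^-1 * end_fun g x)%g : x y / (x * y)%g}.
Proof.
move=> x y; rewrite !end_funM invgM (circle_mulgC (_^-1)%g).
exact: circle_mulACA.
Qed.

(** The preimage psi of phi under the shift, solved recursively from psi_k psi_{k+1} = phi_{k+1}. *)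
Fixpoint unshift_seq (phi : nat -> circle_end R) (k : nat) : circle_end R :=
  if k is k'.+1 then mk_end (@inv_end_subproof (unshift_seq phi k') (phi k))
  else phi 0%N.

Lemma unshiftSE (phi : nat -> circle_end R) k x :
  (end_fun (unshift_seq phi k) x * end_fun (unshift_seq phi k.+1) x)%g =
  end_fun (phi k.+1) x.
Proof. by rewrite /= mulVKg. Qed.

Fact unshift_stirling (phi : nat -> circle_end R) :
  stirling_relations phi -> stirling_relations (unshift_seq phi).
Proof.
move=> [phi0 phiP]; split=> //.
set g := end_fun (unshift_seq phi 1%N).
have gM : {morph g : x y / (x * y)%g} by exact: end_funM.
have fE : end_fun (phi 1%N) = (fun y => y * g y)%g.
  by apply/funext => y; rewrite -unshiftSE -/g [unshift_seq _ 0]/= phi0.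
have E k x : circleQ x ->
    end_fun (unshift_seq phi k) (x ^+ k`!)%g = polyact g k.+1 (falling k) x.
  move=> xQ; elim: k => [|k IHk].
    by rewrite /= phi0 fact0 expg1 /falling big_ord0 -polyC1 polyactC.
  (* After multiplying by psi_k(x^{(k+1)!}), the left side is phi_{k+1}(x^{(k+1)!}). Since phi_1 = 1
     + g additively, this is the falling factorial of degree k+1 at 1 + g; [falling_shift] splits
     off the (k+1)-st power of its predecessor at g, which is the factor just added. *)
  apply: (@mulgI _ (end_fun (unshift_seq phi k) (x ^+ k.+1`!)%g)).
  rewrite unshiftSE phiP // stirling_prodE ?fE //; last first.
    by move=> a b; rewrite gM circle_mulACA.
  rewrite polyact_shift ?size_falling // falling_shift polyactD // polyactMn //.
  rewrite [polyact g k.+2 (falling k) x](polyactS gM) ?size_falling // -IHk.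
  rewrite -circle_morphX; last exact: end_funM.
  by rewrite -expgnA mulnC -factS circle_mulgC.
by move=> k k0 x xQ; rewrite stirling_prodE // E.
Qed.

Definition calTinv phi : H := mk_calH (unshift_stirling (calH_stirling phi)).

Lemma coordS_Tinv k x phi :
  coord k.+1 x (calTinv phi) = ((coord k x (calTinv phi))^-1 * coord k.+1 x phi)%g.
Proof. by []. Qed.

Lemma calTinvK : cancel calTinv T.
Proof.
move=> phi; apply: calH_ext => -[|k] x; first by rewrite !coord0.
by rewrite coordS_T coordS_Tinv mulVKg.
Qed.

Lemma calTK : cancel T calTinv.
Proof.
move=> phi; apply: calH_ext => k; elim: k => [|k IHk] x; first by rewrite !coord0.
by rewrite coordS_Tinv coordS_T IHk mulKg.
Qed.

Lemma continuous_Tinv : continuous calTinv.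
Proof.
apply: continuous_calH => k; elim: k => [|k IHk] x.
  rewrite (_ : _ \o _ = coord 0 x); first exact: continuous_coord.
  by apply/funext => phi /=; rewrite !coord0.
rewrite (_ : _ \o _ =
    fun phi => (coord k x (calTinv phi))^-1 * coord k.+1 x phi)%g //.
apply: continuous_circleM; last exact: continuous_coord.
by apply: continuous_circleV; exact: IHk.
Qed.

Fact end_one_subproof : {morph (fun _ : circle R => 1%g : circle R) : x y / (x
  * y)%g}.
Proof. by move=> x y; rewrite mulg1. Qed.

(** A point showing that H is nonempty: with phi_k trivial for k > 0, both sides of every relation
    are 1. *)
Definition base_seq (k : nat) : circle_end R :=
  if k is 0%N then end_id R else mk_end end_one_subproof.

Fact base_stirling : stirling_relations base_seq.
Proof.
split=> // k k0 x _; case: k k0 => // k _ /=.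
by rewrite big_add1 big1 // => j _; rewrite iterS.
Qed.

Lemma dynamical_calT : dynamical_system T.
Proof.
split; [by exists (mk_calH base_stirling)|exact: compact_calH|exact:
  hausdorff_calH|].
split; first exact: continuous_T.
by exists calTinv; split; [exact: calTK|exact: calTinvK|exact: continuous_Tinv].
Qed.

End ShiftDynamics.

(** * Stone-Weierstrass *)

(* Compactness as an induction principle over sets: this replaces the extraction
   of finite subcovers. *)
Lemma compact_set_ind (X : topologicalType) (P : set X -> Prop) :
  compact [set: X] -> P set0 ->
  (forall A B, A `<=` B -> P B -> P A) ->
  (forall A B, P A -> P B -> P (A `|` B)) ->
  (forall x : X, exists2 A, nbhs x A & P A) -> P setT.
Proof.
move=> cX P0 PS PU Pn; apply: contrapT => nPT.
(* If [P setT] fails, the complements of the sets in [P] form a proper filter; at its cluster point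
   the local hypothesis is contradicted. *)
pose F : set_system X := [set A | P (~` A)].
have FF : ProperFilter F.
  split; first by rewrite /F /= setC0.
  split=> [|A B PA PB|A B AB PA]; first by rewrite /F /= setCT.
    by rewrite /F /= setCI; exact: PU.
  by apply: PS PA; exact: subsetC.
have [x [_ xF]] := cX F FF (filterT : F setT).
have [A Ax PA] := Pn x.
by have [|y [nAy Ay]] := xF (~` A) A _ Ax; first by rewrite /F /= setCK.
Qed.

Section RealStoneWeierstrass.
Variables (R : realType) (X : topologicalType).
Hypothesis cX : compact [set: X].
Implicit Types f g h : X -> R.

Lemma compact_bounded f : continuous f ->
  exists2 M : R, 0 < M & forall x, `|f x| <= M.
Proof.
move=> cf.
suff [M M0 fM] : exists2 M : R, 0 < M & forall x, [set: X] x -> `|f x| <= M.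
  by exists M => // x; exact: fM.
apply: (compact_set_ind
  (P := fun S => exists2 M : R, 0 < M & forall x, S x -> `|f x| <= M)) => //.
- by exists 1.
- by move=> A B AB [M M0 MB]; exists M => // x /AB; exact: MB.
- move=> A B [M M0 MA] [N N0 NB]; exists (M + N); first exact: addr_gt0.
  by move=> x [/MA|/NB] /le_trans; apply; rewrite ?lerDl ?lerDr ltW.
- move=> x; exists [set y | `|f y| < `|f x| + 1].
    have cnf : (fun y => `|f y|) @ x --> `|f x| by apply: cvg_norm; exact: cf.
    by apply: (cvgr_lt _ cnf); rewrite ltrDl.
  exists (`|f x| + 1); first by rewrite ltr_pwDr.
  by move=> y /= /ltW.
Qed.

(** The classical polynomials in t increasing to |t| on [-1, 1]; the Weierstrass theorem itself is
    thereby avoided. *)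
Fixpoint abs_approx (n : nat) (t : R) : R :=
  if n is n'.+1 then abs_approx n' t + (t ^+ 2 - abs_approx n' t ^+ 2) / 2 else 0.

(** The error d = |t| - p passes to at most d (1 - d/2). This expression increases in d on [0, 1],
    and the bound 2/(n+2) propagates because (n+1)(n+3) <= (n+2)^2. *)
Lemma abs_approxP n t : `|t| <= 1 ->
  0 <= abs_approx n t <= `|t| /\ `|t| - abs_approx n t <= 2 / n.+2%:R.
Proof.
move=> t1; have t0 := normr_ge0 t.
elim: n => [|n [/andP[p0 pt] IHn]] /=.
  by rewrite lexx t0 subr0 divff.
move: p0 pt IHn; set p := abs_approx n t => p0 pt.
have -> : t ^+ 2 = `|t| ^+ 2 by rewrite real_normK // num_real.
move: t0 t1 pt; move: `|t| => u u0 u1 pu dn.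
have n0 : 0 < (n%:R + 2 : R) by rewrite ltr_wpDl.
have n30 : 0 < (n%:R + 3 : R) by rewrite ltr_wpDl.
have nE : (n.+2%:R : R) = n%:R + 2 by rewrite -addn2 natrD.
have nE3 : (n.+3%:R : R) = n%:R + 3 by rewrite -addn3 natrD.
rewrite nE in dn; rewrite nE3; split; first by apply/andP; split; nra.
have step : u - (p + (u ^+ 2 - p ^+ 2) / 2) <= (u - p) * (1 - (u - p) / 2) by nra.
apply: (le_trans step); set d := u - p in dn *.
have d1 : d <= 1 by rewrite /d; lra.
have d0 : 0 <= d by rewrite /d; lra.
set c := 2 / (n%:R + 2) in dn.
have c1 : c <= 1 by rewrite /c ler_pdivrMr // mul1r lerDr.
apply: (@le_trans _ _ (c * (1 - c / 2))); first by nra.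
rewrite ler_pdivlMr // /c.
have -> : 2 / (n%:R + 2) * (1 - 2 / (n%:R + 2) / 2) * (n%:R + 3) =
    2 * ((n%:R + 1) * (n%:R + 3) / (n%:R + 2) ^+ 2) :> R.
  by field; rewrite gt_eqF.
rewrite -[leRHS]mulr1 ler_pM2l // ler_pdivrMr ?exprn_gt0 // mul1r.
by nra.
Qed.

Variable A : set (X -> R).
Hypothesis A_continuous : forall f, A f -> continuous f.
Hypothesis A_cst : forall c : R, A (cst c).
Hypothesis A_add : forall f g, A f -> A g -> A (f \+ g).
Hypothesis A_mul : forall f g, A f -> A g -> A (f \* g).
Hypothesis A_sep : forall x y, x != y -> exists2 f, A f & f x != f y.

(** Maxima and minima of members of [A] are only uniform limits of members of [A], so the lattice
    argument runs in this closure. *)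
Definition unif_closure : set (X -> R) :=
  [set f | continuous f /\
     forall e : R, 0 < e -> exists2 g, A g & forall x, `|f x - g x| <= e].

Local Notation B := unif_closure.

Lemma sub_unif_closure f : A f -> B f.
Proof.
move=> Af; split; first exact: A_continuous.
by move=> e e0; exists f => // x; rewrite subrr normr0 ltW.
Qed.

Lemma unif_closureD f g : B f -> B g -> B (f \+ g).
Proof.
move=> [cf Bf] [cg Bg]; split=> [x|e e0]; first by apply: cvgD;
  [exact: cf|exact: cg].
have e2 : 0 < e / 2 by rewrite divr_gt0.
have [f' Af' ff'] := Bf _ e2; have [g' Ag' gg'] := Bg _ e2.
exists (f' \+ g') => [|x]; first exact: A_add.
rewrite /= opprD addrACA (splitr e); apply: le_trans (ler_normD _ _) _.
exact: lerD.
Qed.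

Lemma A_scale (c : R) f : A f -> A (fun x => c * f x).
Proof. by move=> Af; exact: (A_mul (A_cst c)). Qed.

Lemma unif_closureZ (c : R) f : B f -> B (fun x => c * f x).
Proof.
move=> [cf Bf]; split=> [x|e e0].
  by apply: cvgM; [exact: cvg_cst|exact: cf].
have c1 : 0 < `|c| + 1 by rewrite ltr_pwDr.
have [g Ag fg] := Bf (e / (`|c| + 1)) (divr_gt0 e0 c1).
exists (fun x => c * g x) => [|x]; first exact: A_scale.
rewrite -mulrBr normrM; apply: (@le_trans _ _ (`|c| * (e / (`|c| + 1)))).
  by apply: ler_wpM2l => //; exact: fg.
rewrite mulrA ler_pdivrMr // mulrC; apply: ler_wpM2l; first exact: ltW.
by rewrite lerDl.
Qed.

Lemma A_abs_approx n f : A f -> A (fun x => abs_approx n (f x)).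
Proof.
move=> Af; elim: n => [|n IHn] /=; first exact: A_cst.
apply: (A_add IHn).
rewrite (_ : (fun x => _) = fun x => 2^-1 * (f x * f x +
    -1 * (abs_approx n (f x) * abs_approx n (f x)))).
  apply: A_scale; apply: A_add; first exact: A_mul.
  by apply: A_scale; exact: A_mul.
by apply/funext => x; rewrite !expr2; ring.
Qed.

Lemma unif_closure_norm f : B f -> B (fun x => `|f x|).
Proof.
move=> [cf Bf]; split=> [x|e e0]; first by apply: cvg_norm; exact: cf.
have e2 : 0 < e / 2 by rewrite divr_gt0.
have [g Ag fg] := Bf _ e2.
have [M M0 gM] := compact_bounded (A_continuous Ag).
(* After rescaling by the bound [M] to [-1, 1], the error of [abs_approx] is multiplied by [M]; this
   [n] keeps it below e/2. *)
have [n nP] : exists n, 2 / n.+2%:R <= e / 2 / M.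
  exists (Num.truncn (2 / (e / 2 / M))).
  have e3 : 0 < e / 2 / M by rewrite divr_gt0.
  rewrite ler_pdivrMr ?ltr0n // mulrC -ler_pdivrMr //.
  apply/ltW/(lt_trans (truncnS_gt _)).
  by rewrite ltr_nat.
exists (fun x => M * abs_approx n (M^-1 * g x)).
  by apply: A_scale; apply: A_abs_approx; exact: A_scale.
move=> x.
have t1 : `|M^-1 * g x| <= 1.
  by rewrite normrM (ger0_norm (x := M^-1)) ?invr_ge0 ?(ltW M0) // ler_pdivrMl
    // mulr1.
have [/andP[_ pt] dt] := abs_approxP n t1.
have -> : `|f x| - M * abs_approx n (M^-1 * g x) = (`|f x| - `|g x|) +
    M * (`|M^-1 * g x| - abs_approx n (M^-1 * g x)).
  rewrite normrM (ger0_norm (x := M^-1)) ?invr_ge0 ?ltW //.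
  by field; rewrite gt_eqF.
rewrite (splitr e); apply: le_trans (ler_normD _ _) _; apply: lerD.
  by apply: le_trans (fg x); exact: ler_dist_dist.
rewrite ger0_norm; last by rewrite mulr_ge0 ?subr_ge0 // ltW.
rewrite mulrC -ler_pdivlMr //; exact: le_trans nP.
Qed.

Lemma unif_closure_max f g : B f -> B g -> B (fun x => Num.max (f x) (g x)).
Proof.
move=> Bf Bg.
rewrite (_ : (fun x => _) =
    fun x => 2^-1 * ((f x + g x) + `|f x + -1 * g x|)).
  apply: unif_closureZ; apply: unif_closureD; first exact: unif_closureD.
  by apply: unif_closure_norm; apply: unif_closureD => //; exact: unif_closureZ.
by apply/funext => x; rewrite maxr_absE mulN1r mulrC.
Qed.

Lemma unif_closure_min f g : B f -> B g -> B (fun x => Num.min (f x) (g x)).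
Proof.
move=> Bf Bg.
rewrite (_ : (fun x => _) =
    fun x => 2^-1 * ((f x + g x) + -1 * `|f x + -1 * g x|)).
  apply: unif_closureZ; apply: unif_closureD; first exact: unif_closureD.
  apply: unif_closureZ; apply: unif_closure_norm; apply: unif_closureD => //.
  exact: unif_closureZ.
by apply/funext => x; rewrite minr_absE !mulN1r mulrC.
Qed.

Lemma A_interpolate x y (a b : R) : x != y ->
  exists2 f, A f & f x = a /\ f y = b.
Proof.
move=> /A_sep[f Af fxy]; have d0 : f y - f x != 0 by rewrite subr_eq0 eq_sym.
exists (fun z => a + (b - a) / (f y - f x) * (f z + - f x)).
  apply: A_add; first exact: A_cst.
  by apply: A_scale; apply: A_add => //; exact: A_cst.
by split; [rewrite subrr mulr0 addr0|rewrite divfK // addrC subrK].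
Qed.

Lemma nbhs_lt_continuous f g x : continuous f -> continuous g -> f x < g x ->
  nbhs x [set y | f y < g y].
Proof.
move=> cf cg fg; have cgf : (fun y => g y - f y) @ x --> g x - f x.
  by apply: cvgB; [exact: cg|exact: cf].
have : nbhs x [set y | 0 < g y - f y] by apply: (cvgr_gt _ cgf); rewrite subr_gt0.
by apply: filterS => y /=; rewrite subr_gt0.
Qed.

(** Near each y, a member of [A] equal to f at both x and y exceeds f - e. Compactness leaves
    finitely many of them, and their maximum remains below f + e at x. *)
Lemma unif_closure_above f (e : R) x : continuous f -> 0 < e ->
  exists2 g, B g & g x < f x + e /\ forall y, f y - e < g y.
Proof.
move=> cf e0.
suff [g Bg [gx gy]] : exists2 g, B g &
    g x < f x + e /\ forall y, [set: X] y -> f y - e < g y.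
  by exists g => //; split=> // y; exact: gy.
apply: (compact_set_ind (P := fun S => exists2 g, B g &
    g x < f x + e /\ forall y, S y -> f y - e < g y)) => //.
- exists (cst (f x)); first exact/sub_unif_closure/A_cst.
  by split=> //; rewrite ltrDl.
- by move=> S S' SS' [g Bg [gx gy]]; exists g => //; split=> // y /SS'; exact: gy.
- move=> S S' [g Bg [gx gy]] [h Bh [hx hy]].
  exists (fun z => Num.max (g z) (h z)); first exact: unif_closure_max.
  split; first by rewrite gt_max gx.
  by move=> y [/gy|/hy] lt; rewrite lt_max lt ?orbT.
- move=> y.
  have [g Ag [gx gy]] : exists2 g, A g & g x = f x /\ g y = f y.
    have [->|/A_interpolate] := eqVneq x y; last exact.
    by exists (cst (f y)) => //; exact: A_cst.
  exists [set z | f z - e < g z].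
    apply: (nbhs_lt_continuous (f := fun z => f z - e)).
    - by move=> z; apply: cvgB; [exact: cf|exact: cvg_cst].
    - exact: A_continuous.
    - by rewrite gy ltrBlDr ltrDl.
  exists g; first exact: sub_unif_closure.
  by split=> //; rewrite gx ltrDl.
Qed.

(** Each function from [unif_closure_above] lies below f + e/2 near its point x; the minimum of
    finitely many of them is within e/2 of f everywhere. *)
Theorem real_stone_weierstrass f (e : R) : continuous f -> 0 < e ->
  exists2 g, A g & forall x, `|f x - g x| < e.
Proof.
move=> cf e0; have e2 : 0 < e / 2 by rewrite divr_gt0.
suff [g [_ Bg] gf] : exists2 g, B g & (forall y, f y - e / 2 < g y) /\
    forall y, [set: X] y -> g y < f y + e / 2.
  have [h Ah gh] := Bg _ (divr_gt0 e2 (ltr0n _ 2)).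
  exists h => // x; have := gh x; have := gf.1 x; have := gf.2 x I.
  by rewrite ler_norml ltr_norml; lra.
apply: (compact_set_ind (P := fun S => exists2 g, B g &
    (forall y, f y - e / 2 < g y) /\ forall y, S y -> g y < f y + e / 2)) => //.
- have [M M0 fM] := compact_bounded cf.
  exists (cst M); first exact/sub_unif_closure/A_cst.
  split=> // y; have := fM y; rewrite ler_norml /cst; lra.
- by move=> S S' SS' [g Bg [g1 g2]]; exists g => //; split=> // y /SS'; exact: g2.
- move=> S S' [g Bg [g1 g2]] [h Bh [h1 h2]].
  exists (fun z => Num.min (g z) (h z)); first exact: unif_closure_min.
  split; first by move=> y; rewrite lt_min g1 h1.
  by move=> y [/g2|/h2] lt; rewrite gt_min lt ?orbT.
- move=> x; have [g Bg [gx gy]] := unif_closure_above x cf e2.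
  exists [set z | g z < f z + e / 2]; last by exists g.
  apply: (nbhs_lt_continuous (g := fun z => f z + e / 2)) => //; first exact: Bg.1.
  by move=> z; apply: cvgD; [exact: cf|exact: cvg_cst].
Qed.

End RealStoneWeierstrass.

(** * Complex Stone-Weierstrass for spans of circle-valued functions *)

Section CircleSpan.
Variables (R : realType) (X : topologicalType).

(** The linear span of G, given inductively so that closure properties follow by induction;
    [circle_span_sum] recovers indexed sums. *)
Inductive circle_span (G : set (X -> circle R)) : (X -> R[i]) -> Prop :=
| circle_span_gen (c : R[i]) g : G g ->
    circle_span G (fun x => c * circle_val (g x))
| circle_span_add f1 f2 : circle_span G f1 -> circle_span G f2 ->
    circle_span G (fun x => f1 x + f2 x).

Lemma continuous_circle_span (G : set (X -> circle R)) f :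
  (forall g, G g -> continuous g) -> circle_span G f -> continuous f.
Proof.
move=> Gc; elim=> {f} [c g Gg|f1 f2 _ c1 _ c2].
  have /continuous_circleP/continuous_complexP[g1 g2] := Gc g Gg.
  apply/continuous_complexP; split=> x.
    rewrite (_ : _ \o _ =
      fun x => Re c * Re (circle_val (g x)) - Im c * Im (circle_val (g x))).
      by apply: cvgB; (apply: cvgM; first exact: cvg_cst); [exact: g1|exact: g2].
    by apply/funext => y /=; rewrite ReM.
  rewrite (_ : _ \o _ =
    fun x => Re c * Im (circle_val (g x)) + Im c * Re (circle_val (g x))).
    by apply: cvgD; (apply: cvgM; first exact: cvg_cst); [exact: g2|exact: g1].
  by apply/funext => y /=; rewrite ImM.
move: c1 c2 => /continuous_complexP[r1 i1] /continuous_complexP[r2 i2].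
apply/continuous_complexP; split=> x.
  rewrite (_ : _ \o _ = (Re \o f1) \+ (Re \o f2)); first by apply: cvgD;
    [exact: r1|exact: r2].
  by apply/funext => y /=; rewrite raddfD.
rewrite (_ : _ \o _ = (Im \o f1) \+ (Im \o f2)); first by apply: cvgD;
  [exact: i1|exact: i2].
by apply/funext => y /=; rewrite raddfD.
Qed.

Lemma circle_span_sum (G : set (X -> circle R)) f : circle_span G f ->
  exists n (c : 'I_n -> R[i]) (g : 'I_n -> X -> circle R),
    (forall i, G (g i)) /\ forall x, f x = \sum_(i < n) c i * circle_val (g i x).
Proof.
elim=> {f} [c g Gg|f1 f2 _ [n [c [g [Gg E]]]] _ [m [d [h [Gh E']]]]].
  exists 1%N, (fun _ => c), (fun _ => g); split=> // x.
  by rewrite big_ord1.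
exists (n + m)%N, (fun i => match fintype.split i with inl j => c j | inr j =>
  d j end),
  (fun i => match fintype.split i with inl j => g j | inr j => h j end).
split=> [i|x]; first by case: fintype.split.
rewrite big_split_ord /= E E'; congr (_ + _); apply: eq_bigr => i _.
  by have -> : fintype.split (lshift m i) = inl i := unsplitK (inl i).
by have -> : fintype.split (rshift n i) = inr i := unsplitK (inr i).
Qed.

Section StoneWeierstrass.
Hypothesis cX : compact [set: X].
Variable G : set (X -> circle R).
Hypothesis G_continuous : forall g, G g -> continuous g.
Hypothesis G_one : G (fun _ => 1%g).
Hypothesis G_mul : forall g h, G g -> G h -> G (fun x => g x * h x)%g.
Hypothesis G_inv : forall g, G g -> G (fun x => (g x)^-1)%g.
Hypothesis G_sep : forall x y : X, (forall g, G g -> g x = g y) -> x = y.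

Local Notation S := (circle_span G).

Lemma circle_spanZ (c : R[i]) f : S f -> S (fun x => c * f x).
Proof.
elim=> {f} [d g Gg|f1 f2 _ S1 _ S2].
  rewrite (_ : (fun x => _) = fun x => (c * d) * circle_val (g x));
    first exact: circle_span_gen.
  by apply/funext => x; rewrite mulrA.
rewrite (_ : (fun x => _) = fun x => c * f1 x + c * f2 x);
  first exact: circle_span_add.
by apply/funext => x; rewrite mulrDr.
Qed.

Lemma circle_spanM f h : S f -> S h -> S (fun x => f x * h x).
Proof.
move=> Sf Sh; elim: Sf => {f} [c g Gg|f1 f2 _ S1 _ S2]; last first.
  rewrite (_ : (fun x => _) = fun x => f1 x * h x + f2 x * h x);
    first exact: circle_span_add.
  by apply/funext => x; rewrite mulrDl.
elim: Sh => {h} [d k Gk|f1 f2 _ S1 _ S2].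
  rewrite (_ : (fun x => _) = fun x => (c * d) * circle_val (g x * k x)%g).
    by apply: circle_span_gen; exact: G_mul.
  by apply/funext => x; rewrite circle_valM mulrACA.
rewrite (_ : (fun x => _) =
  fun x => c * circle_val (g x) * f1 x + c * circle_val (g x) * f2 x).
  exact: circle_span_add.
by apply/funext => x; rewrite mulrDr.
Qed.

Lemma circle_span_cst (c : R[i]) : S (fun _ => c).
Proof.
rewrite (_ : (fun _ => c) = fun x => c * circle_val ((fun _ => 1%g) x)).
  exact: circle_span_gen.
by apply/funext => x; rewrite -[circle_val _]/1 mulr1.
Qed.

(** The real functions in the span. As inverses on the circle are conjugates, closure of G under
    inversion puts Re g and Im g here. *)
Let A : set (X -> R) := [set u | S (fun x => (u x)%:C)].

Let A_Re g : G g -> A (fun x => Re (circle_val (g x))).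
Proof.
move=> Gg; rewrite /A /= (_ : (fun x => _) =
  fun x => 2^-1 * circle_val (g x) + 2^-1 * circle_val (g x)^-1%g).
  by apply: circle_span_add; apply: circle_span_gen => //; exact: G_inv.
by apply/funext => x;
  rewrite circle_valV -mulrDr addcJ mulrA mulVf ?mul1r // pnatr_eq0.
Qed.

Let A_Im g : G g -> A (fun x => Im (circle_val (g x))).
Proof.
move=> Gg; rewrite /A /= (_ : (fun x => _) =
  fun x => (- 'i / 2) * circle_val (g x) + ('i / 2) * circle_val (g x)^-1%g).
  by apply: circle_span_add; apply: circle_span_gen => //; exact: G_inv.
apply/funext => x; rewrite circle_valV mulNr -mulNr mulrC.
have -> : 'i / 2 * (circle_val (g x))^*%C =
  (- 'i / 2) * (- (circle_val (g x))^*%C) :> R[i].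
  by rewrite !mulNr mulrN opprK.
rewrite (mulrC (circle_val _)) -mulrDr subcJ.
have -> : - 'i / 2 * (2 * (Im (circle_val (g x)))%:C * 'i) =
   - ('i * 'i) * (Im (circle_val (g x)))%:C :> R[i] by field.
by rewrite -expr2 sqrCi opprK mul1r.
Qed.

Theorem circle_stone_weierstrass (f : X -> R[i]) (e : R) : continuous f -> 0 < e ->
  exists2 h, S h & forall x, `|f x - h x| < e%:C.
Proof.
move=> /continuous_complexP[cR cI] e0.
have A_continuous u : A u -> continuous u.
  move=> Au; have /continuous_complexP[+ _] := continuous_circle_span
    G_continuous Au.
  by rewrite (_ : _ \o _ = u).
have A_cst (c : R) : A (cst c) by exact: (circle_span_cst c%:C).
have A_add u v : A u -> A v -> A (u \+ v).
  move=> Au Av; rewrite /A /= (_ : (fun x => _) = fun x => (u x)%:C + (v x)%:C).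
    exact: circle_span_add.
  by apply/funext => x; rewrite raddfD.
have A_mul u v : A u -> A v -> A (u \* v).
  move=> Au Av; rewrite /A /= (_ : (fun x => _) = fun x => (u x)%:C * (v x)%:C).
    exact: circle_spanM.
  by apply/funext => x; rewrite rmorphM.
have A_sep x y : x != y -> exists2 u, A u & u x != u y.
  move=> xy; apply: contrapT => nu; move/eqP: xy; apply; apply: G_sep => g Gg.
  apply: circle_val_inj; apply/eqP; rewrite eq_complex; apply/andP.
  split; apply: contrapT => /negP ne; apply: nu.
    by exists (fun x => Re (circle_val (g x))) => //; exact: A_Re.
  by exists (fun x => Im (circle_val (g x))) => //; exact: A_Im.
have e2 : 0 < e / 2 by rewrite divr_gt0.
have SW := real_stone_weierstrass cX A_continuous A_cst A_add A_mul A_sep.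
have [u Au fu] := SW _ _ cR e2; have [v Av fv] := SW _ _ cI e2.
exists (fun x => (u x)%:C + 'i * (v x)%:C).
  by apply: circle_span_add => //; exact: circle_spanZ.
move=> x; have -> : f x - ((u x)%:C + 'i * (v x)%:C) =
    (Re (f x) - u x)%:C + 'i * (Im (f x) - v x)%:C.
  by rewrite {1}(complexE (f x)) complexiE !raddfB /=; ring.
apply: le_lt_trans (ler_normD _ _) _.
rewrite normrM normCi mul1r !norm_real_complex.
by rewrite [in ltRHS](splitr e) raddfD; apply: ltrD; rewrite ltcR;
  [exact: fu|exact: fv].
Qed.

End StoneWeierstrass.

Lemma dense_Cont (D : set (Cont R X)) :
  (forall f : X -> R[i], continuous f -> forall e : R, 0 < e ->
     exists2 h, D h & forall x, `|f x - (set_val h : X -> R[i]) x| < e%:C) <->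
  dense D.
Proof.
split=> [DP O [f Of] [B oB BO]|dD f cf e e0].
  have cf : continuous (set_val f : X -> R[i]) := set_valP f.
  have : nbhs (set_val f) B by apply: open_nbhs_nbhs; split=> //; rewrite -BO in Of.
  move=> /uniform_nbhs[E [entE EB]].
  have [e e0 eE] : exists2 e : R[i], 0 < e & [set xy | ball xy.1 e xy.2] `<=` E.
    by move: entE; rewrite -entourage_ballE.
  have eE' := gt0_complexE e0.
  have e0' : 0 < Re e by rewrite -ltcR -eE'.
  have [h Dh fh] := DP _ cf _ e0'.
  exists h; split=> //; rewrite -BO; apply: EB => x _; apply: eE => /=.
  by have := fh x; rewrite -eE'.
pose W := [set h : X -> R[i] | forall x, `|f x - h x| < e%:C].
have nW : nbhs (f : {uniform X -> R[i]}) W.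
  apply/uniform_nbhs; exists [set xy | ball xy.1 e%:C xy.2]; split.
    by rewrite -entourage_ballE; exists e%:C => //=; rewrite ltcR.
  by move=> h fh x; exact: fh.
pose f' : Cont R X := exist _ f (mem_set cf).
(* [W] is only known to be a neighbourhood of [f], so density is applied to the interior of its
   trace. *)
have V0 : interior (set_val @^-1` W : set (Cont R X)) !=set0.
  by exists f'; exact: (@continuous_set_val _ _ f' W nW).
have [h [/interior_subset Wh Dh]] := dD _ V0 (open_interior _).
by exists h.
Qed.

End CircleSpan.

(** * Averages along orbits *)

Section Averages.
Variables (R : realType) (X : Type) (T : X -> X).
Local Notation C := R[i].
Implicit Types (f g : X -> C) (s t : seq nat).

(** Averages over arbitrary finite lists of times, not only intervals, so that an average of
    averages is again one. The empty list gives 0, whence the conditions [s != [::]]. *)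
Definition avg s f x : C := (size s)%:R^-1 * \sum_(j <- s) f (iter j T x).

Lemma avgD s f g x : avg s (fun y => f y + g y) x = avg s f x + avg s g x.
Proof. by rewrite /avg big_split mulrDr. Qed.

Lemma avgZ s c f x : avg s (fun y => c * f y) x = c * avg s f x.
Proof. by rewrite /avg -mulr_sumr mulrCA. Qed.

Lemma size_gt0C s : s != [::] -> 0 < (size s)%:R :> C.
Proof. by rewrite ltr0n lt0n size_eq0. Qed.

Lemma avg_cst s c x : s != [::] -> avg s (fun _ => c) x = c.
Proof.
move=> s0; rewrite /avg big_const_seq count_predT iter_addr_0 -[X in _ *
  X]mulr_natl mulKf //.
by rewrite gt_eqF // size_gt0C.
Qed.

Lemma avg_norm s f (c : C) x : s != [::] -> (forall y, `|f y| <= c) ->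
  `|avg s f x| <= c.
Proof.
move=> s0 fc; have n0 := size_gt0C s0.
rewrite /avg normrM (ger0_norm (x := (size s)%:R^-1)) ?invr_ge0 ?(ltW n0) //.
rewrite ler_pdivrMl //.
apply: le_trans (ler_norm_sum _ _ _) _.
apply: (@le_trans _ _ (\sum_(j <- s) c)); first exact: ler_sum.
by rewrite big_const_seq count_predT iter_addr_0 mulr_natl.
Qed.

Lemma avg_conj s f x : avg s (fun y => (f y)^*%C) x = (avg s f x)^*%C.
Proof. by rewrite /avg rmorphM fmorphV rmorph_nat rmorph_sum. Qed.

Lemma avg_iter s f k x : avg s (fun y => f (iter k T y)) x = avg s f (iter k T x).
Proof.
by rewrite /avg; congr (_ * _); apply: eq_bigr => j _; rewrite -!iterD addnC.
Qed.

Lemma avgC s t f x : avg s (avg t f) x = avg t (avg s f) x.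
Proof.
rewrite /avg -!mulr_sumr !mulrA (mulrC (size t)%:R^-1); congr (_ * _).
rewrite exchange_big; apply: eq_bigr => i _; apply: eq_bigr => j _.
by rewrite -!iterD addnC.
Qed.

Lemma avg_comp s t f x :
  avg s (avg t f) x = avg [seq (i + j)%N | i <- s, j <- t] f x.
Proof.
rewrite /avg size_allpairs natrM invfM -mulr_sumr mulrA; congr (_ * _).
rewrite big_allpairs_dep; apply: eq_bigr => i _; apply: eq_bigr => j _.
by rewrite addnC iterD.
Qed.

Lemma allpairs_neq0 s t : s != [::] -> t != [::] ->
  [seq (i + j)%N | i <- s, j <- t] != [::].
Proof. by rewrite -!size_eq0 size_allpairs muln_eq0 => /negPf -> /negPf ->. Qed.

Lemma avg_ge0 s f x : (forall y, 0 <= f y) -> 0 <= avg s f x.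
Proof.
by move=> f0; rewrite mulr_ge0 ?invr_ge0 ?ler0n ?sumr_ge0.
Qed.

(** Nonnegativity of the variance: expand the average of |f - c|^2 with c the average of f. *)
Lemma avg_sqr s f x : s != [::] ->
  `|avg s f x| ^+ 2 <= avg s (fun y => `|f y| ^+ 2) x.
Proof.
move=> s0; set c := avg s f x.
have : 0 <= avg s (fun y => `|f y - c| ^+ 2) x.
  by apply: avg_ge0 => y; rewrite exprn_ge0.
have -> : (fun y => `|f y - c| ^+ 2) =
    fun y => (`|f y| ^+ 2 + (- c^*%C * f y + - c * (f y)^*%C)) + c * c^*%C.
  by apply/funext => y; rewrite !sqr_normc rmorphB /=; ring.
rewrite !avgD !avgZ avg_conj avg_cst // -/c sqr_normc.
set u := avg s _ x; have -> : u + (- c^*%C * c + - c * c^*%C) + c * c^*%C =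
  u - c * c^*%C by ring.
by rewrite subr_ge0.
Qed.

(** Some average is uniformly small over all starting points. The list depends on e, but two lists
    can be combined by composing averages. *)
Definition null f := forall e : C, 0 < e ->
  exists2 s, s != [::] & forall x, `|avg s f x| <= e.

Lemma null_ext f g : f =1 g -> null f -> null g.
Proof. by move=> /funext ->. Qed.

Lemma null0 : null (fun _ => 0).
Proof.
move=> e e0; exists [:: 0%N] => // x.
by rewrite avg_cst // normr0 ltW.
Qed.

Lemma halfC (e : C) : e = e / 2 + e / 2.
Proof. by rewrite -mulrDl -mulr2n -[X in X / _]mulr_natr mulfK // pnatr_eq0. Qed.

(** Composing the averages for f and g preserves both bounds, because averages commute and never
    increase a uniform bound. *)
Lemma nullD f g : null f -> null g -> null (fun x => f x + g x).
Proof.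
move=> nf ng e e0; have e2 : 0 < e / 2 by rewrite divr_gt0.
have [s s0 fs] := nf _ e2; have [t t0 gt] := ng _ e2.
exists [seq (i + j)%N | i <- s, j <- t]; first exact: allpairs_neq0.
move=> x; rewrite -avg_comp.
have -> : avg t (fun y => f y + g y) = fun x => avg t f x + avg t g x.
  by apply/funext => y; rewrite avgD.
rewrite avgD (halfC e); apply: le_trans (ler_normD _ _) _; apply: lerD.
  by rewrite avgC; apply: avg_norm.
exact: avg_norm.
Qed.

Lemma nullZ c f : null f -> null (fun x => c * f x).
Proof.
move=> nf e e0; have c1 : 0 < `|c| + 1 by rewrite ltr_pwDr.
have [s s0 fs] := nf _ (divr_gt0 e0 c1).
exists s => // x; rewrite avgZ normrM.
apply: (@le_trans _ _ (`|c| * (e / (`|c| + 1)))); first exact: ler_wpM2l.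
rewrite mulrA ler_pdivrMr // mulrC; apply: ler_wpM2l; first exact: ltW.
by rewrite lerDl.
Qed.

Lemma null_sum (I : Type) (r : seq I) (P : pred I) (F : I -> X -> C) :
  (forall i, P i -> null (F i)) -> null (fun x => \sum_(i <- r | P i) F i x).
Proof.
move=> nF; elim: r => [|i r IHr].
  by apply: null_ext null0 => x; rewrite big_nil.
have [Pi|nPi] := boolP (P i).
  by apply: null_ext (nullD (nF i Pi) IHr) => x; rewrite big_cons Pi.
by apply: null_ext IHr => x; rewrite big_cons (negPf nPi).
Qed.

Lemma null_iter f k : null f -> null (fun x => f (iter k T x)).
Proof.
by move=> nf e e0; have [s s0 fs] := nf e e0; exists s => // x; rewrite avg_iter.
Qed.

Lemma null_conj f : null f -> null (fun x => (f x)^*%C).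
Proof.
move=> nf e e0; have [s s0 fs] := nf e e0; exists s => // x.
by rewrite avg_conj normcJ.
Qed.

Lemma null_limit f : (forall e : C, 0 < e -> exists2 g, null g &
    forall x, `|f x - g x| <= e) -> null f.
Proof.
move=> fP e e0; have e2 : 0 < e / 2 by rewrite divr_gt0.
have [g ng fg] := fP _ e2; have [s s0 gs] := ng _ e2.
exists s => // x.
have -> : f = fun y => (f y - g y) + g y by apply/funext => y; rewrite subrK.
rewrite avgD (halfC e); apply: le_trans (ler_normD _ _) _; apply: lerD => //.
exact: avg_norm.
Qed.

Lemma archiC (e : C) : 0 < e -> exists n, n.+1%:R^-1 <= e.
Proof.
move=> e0; have eE := gt0_complexE e0.
have e0' : 0 < Re e by rewrite -ltcR -eE.
exists (Num.truncn (Re e)^-1);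
  rewrite eE -(rmorph_nat (real_complex R)) -fmorphV lecR.
rewrite -[leRHS]invrK lef_pV2 ?posrE ?invr_gt0 ?ltr0n //.
exact/ltW/truncnS_gt.
Qed.

(** Along the times 0, M, ..., nM the sum telescopes to two values of f, which are then divided by n
    + 1. *)
Lemma null_coboundary f M (c : C) : (forall x, `|f x| <= c) ->
  null (fun x => f (iter M T x) - f x).
Proof.
move=> fc e e0.
have c0 (x : X) : 0 <= c by exact: le_trans (fc x).
have [n nP] := archiC (divr_gt0 e0 (ltr_pwDr (@ltr01 C) (normr_ge0 (c *+ 2)))).
pose s := [seq (j * M)%N | j <- iota 0 n.+1].
exists s => // x.
have -> : avg s (fun y => f (iter M T y) - f y) x =
    n.+1%:R^-1 * (f (iter (n.+1 * M) T x) - f x).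
  have := telescope_sumr (fun j => f (iter (j * M) T x)) (leq0n n.+1).
  rewrite /index_iota subn0 mul0n => <-.
  rewrite /avg size_map size_iota big_map; congr (_ * _).
  by apply: eq_bigr => j _; rewrite -iterD mulSn.
rewrite normrM (ger0_norm (x := n.+1%:R^-1)) ?invr_ge0 ?ler0n //.
have le2 : `|f (iter (n.+1 * M) T x) - f x| <= `|c *+ 2| + 1.
  apply: le_trans (ler_normB _ _) _; apply: (@le_trans _ _ (c *+ 2)).
    by rewrite mulr2n; apply: lerD.
  by rewrite ger0_norm ?mulrn_wge0 ?(c0 x) // lerDl.
apply: (@le_trans _ _ (e / (`|c *+ 2| + 1) * (`|c *+ 2| + 1))).
  by apply: ler_pM => //; rewrite invr_ge0.
by rewrite divfK // gt_eqF // ltr_pwDr.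
Qed.

(* van der Corput's difference lemma *)
Lemma null_vdc f M : (forall x, `|f x| = 1) ->
  (forall j, (0 < j)%N -> null (fun x => f (iter (j * M) T x) * (f x)^*%C)) ->
  null f.
Proof.
move=> f1 nf e e0.
have e2 : 0 < e ^+ 2 / 2 by rewrite divr_gt0 // exprn_gt0.
have [n nP] := archiC e2.
pose s := [seq (j * M)%N | j <- iota 0 n.+1].
have s0 : s != [::] by [].
pose F i j x := f (iter (i * M) T x) * (f (iter (j * M) T x))^*%C.
(* For j < i, [F i j] is the hypothesis at lag i - j, moved by jM steps; exchanging i and j
   conjugates it. *)
have nF (i j : nat) : i != j -> null (F i j).
  have base i' j' : (j' < i')%N -> null (F i' j').
    move=> ij; have := null_iter (j' * M) (nf (i' - j')%N _).
    rewrite subn_gt0 => /(_ ij); apply: null_ext => x.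
    by rewrite -iterD -mulnDl subnK // ltnW.
  rewrite neq_ltn => /orP[ij|]; last exact: base.
  apply: null_ext (null_conj (base _ _ ij)) => x.
  by rewrite /F (rmorphM (@conjc R)) /= conjcK mulrC.
pose K x := \sum_(i <- iota 0 n.+1) \sum_(j <- iota 0 n.+1 | i != j) F i j x.
have nK : null (fun x => n.+1%:R^-1 ^+ 2 * K x).
  by apply: nullZ; apply: null_sum => i _; apply: null_sum => j; exact: nF.
have [t t0 Kt] := nK _ e2.
(* Expanding the square, the n + 1 diagonal terms equal 1 and contribute 1/(n+1); the other terms
   form the null function [K]. *)
have sqr x : `|avg s f x| ^+ 2 = n.+1%:R^-1 ^+ 2 * K x + n.+1%:R^-1.
  rewrite sqr_normc /avg size_map size_iota rmorphM fmorphV rmorph_nat rmorph_sum.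
  rewrite !big_map mulrACA -expr2 big_distrlr /=.
  have -> : \sum_(i <- iota 0 n.+1) \sum_(j <- iota 0 n.+1)
      f (iter (i * M) T x) * (f (iter (j * M) T x))^*%C =
    K x + n.+1%:R.
    rewrite /K; have -> : (n.+1%:R : C) = \sum_(i <- iota 0 n.+1) 1.
      by rewrite big_const_seq count_predT size_iota iter_addr_0.
    have := iota_uniq 0 n.+1; move: (iota 0 n.+1) => r ur.
    rewrite -big_split /=; apply: eq_big_seq => i ir.
    rewrite (bigD1_seq i) //= [LHS]addrC -sqr_normc f1 expr1n; congr (_ + _).
    by apply: eq_bigl => j; rewrite eq_sym.
  have a0 : (n.+1%:R : C) != 0 by rewrite pnatr_eq0.
  rewrite mulrDr; congr (_ + _); move: a0; move: (n.+1%:R) => a a0.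
  by field.
exists [seq (i + j)%N | i <- t, j <- s]; first exact: allpairs_neq0.
(* Average over [s] first, then over [t]: [avg_sqr] moves the square inside the outer average, where
   [K] is small. *)
move=> x; rewrite -avg_comp.
rewrite -(ler_pXn2r (isT : (0 < 2)%N)) ?nnegrE ?normr_ge0 ?(ltW e0) //.
apply: le_trans (avg_sqr _ _ t0) _.
have -> : (fun y => `|avg s f y| ^+ 2) =
  fun x => n.+1%:R^-1 ^+ 2 * K x + n.+1%:R^-1.
  exact/funext.
have real0 : 0 <= avg t (fun x => n.+1%:R^-1 ^+ 2 * K x + n.+1%:R^-1) x.
  by apply: avg_ge0 => y; rewrite -sqr exprn_ge0.
rewrite -(ger0_norm real0) avgD avg_cst // [leRHS]halfC.
apply: le_trans (ler_normD _ _) _; apply: lerD => //.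
by rewrite ger0_norm // invr_ge0.
Qed.

End Averages.

(** * Characters of the sequence space *)

Section Characters.
Variable R : realType.
Local Notation H := (calH R).
Local Notation T := (@calT R).
Implicit Types (u v : circle R) (phi psi : H) (x y : nat -> circle R) (k m : nat).

(** The product of the e_{k,x_k} for k <= m; the factor k = 0 is the constant x_0. *)
Fixpoint chi m x phi : circle R :=
  if m is m'.+1 then (chi m' x phi * coord m (x m) phi)%g else x 0%N.

Lemma chi_ext m x y phi : (forall k, (k <= m)%N -> x k = y k) ->
  chi m x phi = chi m y phi.
Proof.
elim: m => [|m IHm] xy /=; first exact: xy.
by rewrite IHm => [|k km]; rewrite xy // leqW.
Qed.

Lemma chiM m x y phi : (chi m x phi * chi m y phi)%g =
  chi m (fun k => x k * y k)%g phi.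
Proof. by elim: m => // m IHm /=; rewrite coordM -IHm circle_mulACA. Qed.

Lemma coord1 k phi : coord k 1%g phi = 1%g.
Proof. exact: (circle_morph1 (@coord_morph R k phi)). Qed.

Lemma chi1 m phi : chi m (fun _ => 1%g) phi = 1%g.
Proof. by elim: m => // m IHm /=; rewrite IHm coord1 mulg1. Qed.

Lemma chiV m x phi : ((chi m x phi)^-1 = chi m (fun k => (x k)^-1) phi)%g.
Proof.
apply: (@mulgI _ (chi m x phi)); rewrite mulgV chiM -[LHS](chi1 m phi).
by apply: chi_ext => k _; rewrite mulgV.
Qed.

Lemma chi_pad m n x phi :
  chi (m + n) (fun k => if (k <= m)%N then x k else 1%g) phi = chi m x phi.
Proof.
elim: n => [|n IHn]; first by rewrite addn0; apply: chi_ext => k ->.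
by rewrite addnS /= IHn leqNgt ltnS leq_addr coord1 mulg1.
Qed.

Lemma chi_single k u phi : chi k (fun j => if j == k then u else 1%g) phi =
  coord k u phi.
Proof.
case: k => [|k]; first by rewrite coord0.
rewrite /= eqxx (@chi_ext k _ (fun _ => 1%g)) ?chi1 ?mul1g // => j.
by rewrite -ltnS => /ltn_eqF ->.
Qed.

(** Each factor e_{k+1,x_{k+1}} contributes e_{k,x_{k+1}}: the multiplier is the character with
    coefficients moved down by one place. *)
Lemma chi_shift m x phi :
  chi m.+1 x (T phi) = (chi m (fun k => x k.+1) phi * chi m.+1 x phi)%g.
Proof.
elim: m => [|m IHm];
  first by rewrite /= coordS_T coord0 !mulgA (circle_mulgC (x 0%N)).
rewrite -[LHS]/(chi m.+1 x (T phi) * coord m.+2 (x m.+2) (T phi))%g.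
by rewrite IHm coordS_T circle_mulACA.
Qed.

Lemma continuous_chi m x : continuous (chi m x).
Proof.
elim: m => [|m IHm].
  exact: (@cst_continuous H (circle R) (x 0%N)).
rewrite (_ : chi m.+1 x = fun phi => chi m x phi * coord m.+1 (x m.+1) phi)%g //.
by apply: continuous_circleM => //; exact: continuous_coord.
Qed.

Lemma quasi_eigen_chi m x : quasi_eigen T m (chi m x).
Proof.
elim: m x => [|m IHm] x; first by exists (x 0%N).
split; first exact: continuous_chi.
by exists (chi m (fun k => x k.+1)) => // phi; rewrite chi_shift.
Qed.

Definition characters : set (H -> circle R) :=
  [set g | exists m x, g = chi m x].

Lemma charactersM g h : characters g -> characters h ->
  characters (fun phi => g phi * h phi)%g.
Proof.
move=> [m [x ->]] [n [y ->]]; exists (m + n)%N.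
exists (fun k => (if (k <= m)%N then x k else 1) * (if (k <= n)%N then y k else
  1))%g.
by apply/funext => phi; rewrite -chiM chi_pad addnC chi_pad.
Qed.

Lemma charactersV g : characters g -> characters (fun phi => (g phi)^-1)%g.
Proof.
move=> [m [x ->]]; exists m, (fun k => (x k)^-1)%g.
by apply/funext => phi; rewrite chiV.
Qed.

Lemma characters_dense (f : H -> R[i]) (e : R) : continuous f -> 0 < e ->
  exists2 h, circle_span characters h & forall phi, `|f phi - h phi| < e%:C.
Proof.
apply: circle_stone_weierstrass.
- exact: compact_calH.
- by move=> g [m [x ->]]; exact: continuous_chi.
- by exists 0%N, (fun _ => 1%g).
- exact: charactersM.
- exact: charactersV.
- move=> phi psi E; apply: calH_ext => k u.
  by rewrite -!chi_single; apply: E; exists k; eexists.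
Qed.

Lemma quasi_discrete_calT : quasi_discrete_spectrum R T.
Proof.
apply/dense_Cont => f cf e e0.
have [h Sh fh] := characters_dense cf e0.
have ch : continuous h.
  by apply: continuous_circle_span Sh => g [m [x ->]]; exact: continuous_chi.
exists (exist _ h (mem_set ch) : Cont R H) => //.
have [n [c [g [Gg hE]]]] := circle_span_sum Sh.
exists n, c, g; split=> // i.
by have [m [x ->]] := Gg i; exists m => //; exact: quasi_eigen_chi.
Qed.

(** Only the top coefficient of the multiplier of T^h is recorded: each step contributes one factor
    x_{m+1} at index m, and all further corrections have lower index. *)
Lemma chi_shift_iter h m x : exists y,
  y m = (x m.+1 ^+ h)%g /\
  forall phi, chi m.+1 x (iter h T phi) = (chi m y phi * chi m.+1 x phi)%g.
Proof.
elim: h m x => [|h IHh] m x.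
  by exists (fun _ => 1%g); split=> // phi; rewrite chi1 mul1g.
have [y [ym yP]] := IHh m x.
(* The one-step multiplier itself changes under T^h by a character of index below m, padded here to
   have top coefficient 1. *)
have [z [zm zP]] : exists z, z m = 1%g /\ forall phi,
    chi m (fun k => x k.+1) (iter h T phi) =
    (chi m z phi * chi m (fun k => x k.+1) phi)%g.
  case: m {y ym yP} => [|m].
    by exists (fun _ => 1%g); split=> // phi; rewrite chi1 mul1g.
  have [z [_ zP]] := IHh m (fun k => x k.+1).
  exists (fun k => if (k <= m)%N then z k else 1%g); rewrite ltnn; split=> // phi.
  by rewrite zP -[in RHS]addn1 chi_pad addn1.
exists (fun k => z k * x k.+1 * y k)%g; split.
  by rewrite zm ym mul1g expgS.
by move=> phi; rewrite iterS chi_shift zP yP -!chiM !mulgA.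
Qed.

Definition periodic_fun (f : H -> circle R) :=
  exists2 M, (0 < M)%N & forall phi, f (iter M T phi) = f phi.

Lemma periodic_mul (f : H ->
  circle R) M j : (forall phi, f (iter M T phi) = f phi) ->
  forall phi, f (iter (j * M) T phi) = f phi.
Proof.
by move=> fM; elim: j => // j IHj phi; rewrite mulSn iterD fM IHj.
Qed.

Lemma periodicM f g : periodic_fun f -> periodic_fun g ->
  periodic_fun (fun phi => f phi * g phi)%g.
Proof.
move=> [M M0 fM] [N N0 gN]; exists (M * N)%N; first by rewrite muln_gt0 M0.
by move=> phi; rewrite (periodic_mul _ gN) mulnC (periodic_mul _ fM).
Qed.

(** If M is a period of e_{k,u}, then T^M multiplies e_{k+1,u} by a T^M-invariant N-th root of
    unity, so NM is a period of e_{k+1,u}. *)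
Lemma periodic_coord k u : torsion u -> periodic_fun (coord k u).
Proof.
move=> [N N0 uN]; elim: k => [|k [M M0 IHk]].
  by exists 1%N => // phi; rewrite !coord0.
(* The cocycle of e_{k+1,u}: the product of e_{k,u} over the first h points of the orbit. *)
pose Q h phi := iteri h (fun j a => coord k u (iter j T phi) * a)%g 1%g.
have QP h phi : coord k.+1 u (iter h T phi) = (Q h phi * coord k.+1 u phi)%g.
  elim: h => [|h IHh]; first by rewrite mul1g.
  by rewrite iterS coordS_T IHh mulgA.
have QM h phi : Q h (iter M T phi) = Q h phi.
  by elim: h => //= h ->; rewrite -iterD addnC iterD IHk.
have QN h phi : (Q h phi ^+ N)%g = 1%g.
  elim: h => [|h IHh]; first by rewrite expg1n.
  rewrite /= expgMn ?IHh ?mulg1; last exact: circle_mulgC.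
  by apply: morph_root_of_unity => //; exact: coord_morph.
have E i phi : coord k.+1 u (iter (i * M) T phi) =
  (Q M phi ^+ i * coord k.+1 u phi)%g.
  elim: i phi => [|i IHi] phi; first by rewrite mul1g.
  by rewrite mulSn addnC iterD IHi QM QP mulgA -expgSr.
exists (N * M)%N; first by rewrite muln_gt0 N0.
by move=> phi; rewrite E QN mul1g.
Qed.

(* Differencing chi m x along multiples of the period of tau removes tau and
   lowers m, while the top coefficient remains of infinite order. *)
Lemma null_chi m x (tau : H -> circle R) : (0 < m)%N -> periodic_fun tau ->
  ~ torsion (x m) -> null T (fun phi => circle_val (tau phi * chi m x phi)%g).
Proof.
case: m => // m _; elim: m x tau => [|m IHm] x tau [M M0 tauM] xm.
  have xM : (x 1%N ^+ M)%g <> 1%g by move=> xM; apply: xm; exists M.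
  have [y [y0 yP]] := chi_shift_iter M 0 x.
  set f := fun phi => _.
  have fM phi : f (iter M T phi) = circle_val (x 1%N ^+ M)%g * f phi.
    rewrite -circle_valM /f tauM yP -[chi 0 y phi]/(y 0%N) y0.
    by rewrite !mulgA (circle_mulgC (tau phi)).
  have b1 : circle_val (x 1%N ^+ M)%g - 1 != 0.
    by rewrite subr_eq0; apply/eqP => b1; apply: xM; exact: circle_val_inj.
  (* As f o T^M = b f with b = x_1^M different from 1, f is the coboundary f o T^M - f divided by b
     - 1. *)
  apply: null_ext (nullZ (circle_val (x 1%N ^+ M)%g - 1)^-1
    (@null_coboundary _ _ T f M 1 _)) => phi.
    by rewrite fM -{2}[f phi]mul1r -mulrBl mulKf.
  by rewrite norm_circle_val.
apply: (@null_vdc _ _ _ _ M) => [phi|j j0]; first exact: norm_circle_val.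
have [y [ym yP]] := chi_shift_iter (j * M) m.+1 x.
apply: null_ext (IHm y (fun _ => 1%g) _ _) => [phi||].
- rewrite (periodic_mul _ tauM) yP -circle_valV -circle_valM mul1g;
    congr circle_val.
  by rewrite mulgA (circle_mulgC (tau phi) (chi m.+1 y phi)) -[X in (X /
    _)%g]mulgA mulgK.
- by exists 1%N.
(* The top coefficient of the difference is x_{m+2}^{jM} for the present [m]; were it a root of
   unity, x_{m+2} would be one too. *)
- rewrite ym => -[N N0 yN]; apply: xm; exists (j * M * N)%N.
    by rewrite !muln_gt0 j0 M0.
  by rewrite expgnA.
Qed.

(** Descend from the top coefficient. If it has infinite order, [null_chi] applies; if it is
    torsion, its factor is periodic and is absorbed into [tau]. *)
Lemma chi_torsion_or_null m x :
  (forall k, (0 < k <= m)%N -> torsion (x k)) \/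
  (forall tau, periodic_fun tau ->
     null T (fun phi => circle_val (tau phi * chi m x phi)%g)).
Proof.
elim: m => [|m IHm]; first by left=> -[].
have [tm|ntm] := pselect (torsion (x m.+1)); last first.
  by right=> tau ptau; exact: null_chi.
case: IHm => [tx|nx].
  left=> k /andP[k0]; rewrite leq_eqVlt => /orP[/eqP->//|km].
  by apply: tx; rewrite k0.
right=> tau ptau.
apply: null_ext (nx _ (periodicM ptau (periodic_coord m.+1 tm))) => phi.
by rewrite /= -!mulgA (circle_mulgC (coord _ _ _)).
Qed.

End Characters.

(** * Minimality *)

Section Minimality.
Variable R : realType.
Local Notation H := (calH R).
Local Notation T := (@calT R).
Implicit Types (u : circle R) (phi psi w : H) (x y : nat -> circle R) (k m : nat).

Lemma coord1_iter n u phi : coord 1 u (iter n T phi) = (u ^+ n * coord 1 u phi)%g.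
Proof.
elim: n => [|n IHn]; first by rewrite mul1g.
by rewrite iterS coordS_T coord0 IHn mulgA -expgS.
Qed.

(** The odometer: phi_1 acts on N-th roots of unity through one exponent mod N, and each application
    of T raises it by 1. *)
Lemma match_roots_of_unity phi psi N : (0 < N)%N ->
  exists n, forall u, (u ^+ N)%g = 1%g -> coord 1 u (iter n T phi) = coord 1 u psi.
Proof.
move=> N0; have root_of chi' : {morph chi' : u v / (u * v)%g} ->
    exists a, chi' (zeta R N) = (zeta R N ^+ a)%g.
  move=> cM; apply: root_of_unity_zeta => //.
  by apply: morph_root_of_unity => //; exact: zeta_order.
have [a phia] := root_of _ (@coord_morph R 1 phi).
have [b psib] := root_of _ (@coord_morph R 1 psi).
(* A natural number congruent to b - a modulo N. *)
exists (b + a * N.-1)%N => u /(root_of_unity_zeta N0)[i ->].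
have /= -> := circle_morphX (@coord_morph R 1 psi) i (zeta R N).
have /= -> := circle_morphX (@coord_morph R 1 (iter (b + a * N.-1) T phi)) i
  (zeta R N).
congr (_ ^+ _)%g; rewrite coord1_iter psib phia -expgnDr -addnA -mulnSr prednK //.
by rewrite expgnDr mulnC expgnA zeta_order // expg1n mulg1.
Qed.

(** Take w to be a cluster point of iterates matching psi_1 on the j!-th roots of unity. Every N
    divides j! once j >= N, so w_1 and psi_1 agree on all torsion. *)
Lemma match_torsion phi psi : exists w,
  (forall A, nbhs w A -> exists n, A (iter n T phi)) /\
  forall k u, torsion u -> coord k u w = coord k u psi.
Proof.
have H0 j : exists n, forall u, (u ^+ j`!)%g = 1%g ->
    coord 1 u (iter n T phi) = coord 1 u psi.
  by apply: match_roots_of_unity; exact: fact_gt0.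
have [n nP] := boolp.choice H0.
have [w [_ wP]] := @compact_calH R ((fun j => iter (n j) T phi) @ \oo) _ filterT.
have w1 N u : (0 < N)%N -> (u ^+ N)%g = 1%g -> coord 1 u w = coord 1 u psi.
  move=> N0 uN.
  have cl : closed [set w | coord 1 u w = cst (coord 1 u psi) w].
    apply: closed_equalizer; [exact: hausdorff_circle|exact: continuous_coord|].
    exact: cst_continuous.
  apply: cl => A Aw; apply: wP Aw.
  exists N => // j /= Nj; apply: nP.
  have /dvdnP[q ->] : (N %| j`!)%N by apply: dvdn_fact; rewrite N0.
  by rewrite mulnC expgnA uN expg1n.
exists w; split=> [A Aw|k u tu].
  have [|z [[j _ <-] Az]] := wP [set iter (n j) T phi | j in setT] A _ Aw.
    by exists 0%N => // j _; exists j.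
  by exists (n j).
(* Write u = v^{k!}; the Stirling relation then expresses the k-th coordinate at u through the first
   one on roots of unity. *)
have [v vQ <-] := torsion_root (fact_gt0 k) tu.
have [N N0 vN] := circleQ_torsion vQ.
rewrite !coord_stirling //; apply: polyact_agree vN _; first exact: coord_morph.
by move=> z zN; exact: w1 zN.
Qed.

(** * Translations trivial on roots of unity *)

Section Twist.
Variables w psi : H.
Hypothesis agree : forall k u, torsion u -> coord k u w = coord k u psi.

(* twist translates by psi / w, which is trivial on torsion; this preserves the
   Stirling relations. *)
Fact twist_morph phi k :
  {morph (fun u => coord k u phi * ((coord k u w)^-1 * coord k u psi))%g :
    u v / (u * v)%g}.
Proof.
move=> u v; rewrite !coordM invgM (circle_mulgC (coord k v w)^-1)%g.
by rewrite (circle_mulACA (coord k u w)^-1)%g circle_mulACA.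
Qed.

Fact twist_stirling phi : stirling_relations (fun k => mk_end (twist_morph phi k)).
Proof.
have E k u : torsion u ->
    (coord k u phi * ((coord k u w)^-1 * coord k u psi))%g = coord k u phi.
  by move=> tu; rewrite agree // mulVg mulg1.
split=> [|k k0 u uQ].
  apply: circle_endP => u.
  transitivity (coord 0 u phi * ((coord 0 u w)^-1 * coord 0 u psi))%g => //.
  by rewrite !coord0 mulVg mulg1.
transitivity (coord k (u ^+ k`!)%g phi).
  by apply: E; exact/torsionX/circleQ_torsion.
have [N N0 uN] := circleQ_torsion uQ.
rewrite stirling_prodE //; last exact: twist_morph.
rewrite coord_stirling //; apply: polyact_agree uN _; first exact: coord_morph.
by move=> v vN; apply/esym/E; exists N.
Qed.

Definition twist phi : H := mk_calH (twist_stirling phi).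

Lemma coord_twist k u phi :
  coord k u (twist phi) = (coord k u phi * ((coord k u w)^-1 * coord k u psi))%g.
Proof. by []. Qed.

Lemma continuous_twist : continuous twist.
Proof.
apply: continuous_calH => k u.
apply: continuous_circleM; first exact: continuous_coord.
exact: cst_continuous.
Qed.

Lemma twist_id : twist w = psi.
Proof. by apply: calH_ext => k u; rewrite coord_twist mulVKg. Qed.

Lemma chi_twist m x phi :
  chi m x (twist phi) = (chi m x phi * ((chi m x w)^-1 * chi m x psi))%g.
Proof.
elim: m => [|m IHm]; first by rewrite mulVg mulg1.
rewrite /= IHm coord_twist circle_mulACA invgM.
congr (_ * _)%g; rewrite circle_mulACA; congr (_ * _)%g.
exact: circle_mulgC.
Qed.

Lemma chi_agree m x : (forall k, (0 < k <= m)%N -> torsion (x k)) ->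
  chi m x w = chi m x psi.
Proof.
elim: m => // m IHm tx /=; rewrite IHm ?agree //; first by apply: tx; rewrite leqnn.
by move=> k /andP[k0 km]; apply: tx; rewrite k0 leqW.
Qed.

(** By density it suffices to treat a character. With torsion coefficients it is unchanged by the
    twist; otherwise it is null, and twisting multiplies it by a constant. *)
Lemma null_twist (f : H -> R[i]) : continuous f ->
  null T (fun phi => f (twist phi) - f phi).
Proof.
move=> cf; apply: null_limit => e e0.
have eE := gt0_complexE e0.
have e2 : 0 < Re e / 2 by rewrite divr_gt0 // -ltcR -eE.
have [h Sh fh] := characters_dense cf e2.
exists (fun phi => h (twist phi) - h phi); last first.
  move=> phi; have -> : f (twist phi) - f phi - (h (twist phi) - h phi) =
    (f (twist phi) - h (twist phi)) - (f phi - h phi) by ring.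
  have {1}-> : e = (Re e / 2)%:C + (Re e / 2)%:C by rewrite -raddfD /= -splitr.
  apply: le_trans (ler_normB _ _) _.
  by apply: lerD; apply/ltW/fh.
elim: Sh => {h fh} [c g [m [x ->]]|h1 h2 _ n1 _ n2]; last first.
  by apply: null_ext (nullD n1 n2) => phi; ring.
have [tx|nx] := chi_torsion_or_null m x.
  apply: null_ext (@null0 R H T) => phi.
  by rewrite chi_twist chi_agree // mulVg mulg1 subrr.
have := nx (fun _ => 1%g) (ex_intro2 _ _ 1%N isT (fun _ => erefl)).
pose d := circle_val ((chi m x w)^-1 * chi m x psi)%g.
move=> /(nullZ (c * (d - 1))); apply: null_ext => phi.
by rewrite mul1g chi_twist circle_valM -/d; ring.
Qed.

End Twist.

(* If the orbit avoided U, the closed set Z of points whose forward orbit avoids U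
   would be covered by finitely many sets where f, twisted and shifted, is large.
   The sum F of these functions differs from r f by a null function, although f
   vanishes on Z. *)
Theorem forward_dense phi (U : set H) : open U -> U !=set0 ->
  exists n, U (iter n T phi).
Proof.
move=> oU [psi Upsi]; apply: contrapT => nU.
have [f [cf f0 f1 fpsi]] : exists f : H -> R, [/\ continuous f,
    forall v, 0 <= f v, forall v, ~ U v -> f v = 0 & f psi = 1].
  have nH : normal_space H by apply: compact_normal;
    [exact: hausdorff_calH|exact: compact_calH].
  have /(@uniform_separatorP _ R)[f [cf f01 fU fpsi]] :
      uniform_separator (~` U) [set psi].
    apply: (iffLR (@normal_separatorP R H) nH).
    - exact: open_closedC.
    - exact/accessible_closed_set1/hausdorff_accessible/hausdorff_calH.
    - by rewrite -subset0 => v [nUv vpsi]; apply: nUv; rewrite vpsi.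
  exists f; split=> // [v|v nUv|].
  - by have /= := f01 (f v) (ex_intro2 _ _ v I erefl); rewrite in_itv /= => /andP[].
  - by apply: fU; exists v.
  - by apply: fpsi; exists psi.
pose Z := [set v : H | forall n, ~ U (iter n T v)].
(* [P] is stable under unions by adding the functions [F] and the multiplicities [r]; nonnegativity
   preserves the lower bound 1/2. *)
pose P (S : set H) := exists (F : H -> R) (r : R),
  [/\ null T (fun v => (F v)%:C - r%:C * (f v)%:C), forall v, 0 <= F v &
      forall v, S v -> Z v -> 1 / 2 < F v].
have [F [r [nF F0 FZ]]] : P setT.
  apply: compact_set_ind; first exact: compact_calH.
  - exists (fun _ => 0), 0; split=> //.
    by apply: null_ext (@null0 R H T) => v; rewrite mul0r subrr.
  - by move=> A B AB [F [r [nF F0 FB]]]; exists F, r; split=> // v /AB; exact: FB.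
  - move=> A B [F [r [nF F0 FA]]] [G [s [nG G0 GB]]].
    exists (fun v => F v + G v), (r + s); split=> [|v|v].
    + by apply: null_ext (nullD nF nG) => v; rewrite !raddfD /=; ring.
    + exact: addr_ge0.
    + move=> [Av|Bv] Zv; first by rewrite ltr_wpDr // FA.
      by rewrite ltr_wpDl // GB.
  - move=> v; have [Zv|nZv] := pselect (Z v); last first.
      have [n Un] : exists n, U (iter n T v).
        by apply: contrapT => nex; apply: nZv => n Un; apply: nex; exists n.
      exists [set v' | U (iter n T v')].
        by apply: continuous_iter_T; exact: open_nbhs_nbhs.
      exists (fun _ => 0), 0; split=> //.
        by apply: null_ext (@null0 R H T) => v'; rewrite mul0r subrr.
      by move=> v' Uv' /(_ n).
    (* The forward orbit of v accumulates at w, which the twist carries to psi, where f = 1; hence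
       some twisted iterate of v has f > 1/2. *)
    have [w [wv agree]] := match_torsion v psi.
    have cft : continuous (f \o twist agree).
      by move=> v'; apply: continuous_comp; [exact: continuous_twist|exact: cf].
    have [n fn] : exists n, 1 / 2 < f (twist agree (iter n T v)).
      apply: (wv [set v' | 1 / 2 < f (twist agree v')]); have := @cft w;
        rewrite /continuous_at /= twist_id fpsi => c1.
      by apply: (cvgr_gt _ c1); lra.
    exists [set v' | 1 / 2 < f (twist agree (iter n T v'))].
      have cfn : continuous (fun v' => f (twist agree (iter n T v'))).
        by move=> v'; apply: (@continuous_comp _ _ _ (iter n T) (f \o twist
          agree)); [exact: continuous_iter_T|exact: cft].
      exact: (cvgr_gt _ (cfn v)).
    exists (fun v' => f (twist agree (iter n T v'))), 1; split=> //.
    have cfC : continuous (fun v => (f v)%:C).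
      by apply/continuous_complexP; split=> //; exact: (@cst_continuous H R 0).
    (* The difference f o twist o T^n - f is the sum of (f o twist - f) o T^n and the coboundary f o
       T^n - f. *)
    have N1 := null_iter n (null_twist agree cfC).
    have [M M0 fM] := compact_bounded (@compact_calH R) cf.
    have N2 : null T (fun v => (f (iter n T v))%:C - (f v)%:C).
      apply: (@null_coboundary _ _ T (fun v => (f v)%:C) n M%:C) => v'.
      by rewrite norm_real_complex lecR.
    by apply: null_ext (nullD N1 N2) => v'; rewrite /= mul1r; ring.
have Zphi n : Z (iter n T phi).
  by move=> k Uk; apply: nU; exists (k + n)%N; rewrite iterD.
(* Along the orbit of phi, f vanishes and F > 1/2, so no average of F - r f there can have modulus
   at most 1/4. *)
have e4 : 0 < ((1 / 4 : R)%:C) by rewrite ltcR; lra.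
have [s s0 /(_ phi)] := nF _ e4.
rewrite /avg.
have -> : \sum_(j <- s) ((F (iter j T phi))%:C - r%:C * (f (iter j T phi))%:C) =
    (\sum_(j <- s) F (iter j T phi))%:C.
  rewrite raddf_sum; apply: eq_bigr => j _; rewrite f1 ?mulr0 ?subr0 //.
  exact: (Zphi j 0%N).
have n0 : 0 < ((size s)%:R : R) by rewrite ltr0n lt0n size_eq0.
rewrite -(rmorph_nat (real_complex R)) -fmorphV -rmorphM /=.
rewrite norm_real_complex lecR => le4.
have : (1 / 2) * (size s)%:R <= \sum_(j <- s) F (iter j T phi).
  have -> : (1 / 2) * (size s)%:R = \sum_(j <- s) (1 / 2 : R).
    by rewrite big_const_seq count_predT iter_addr_0 mulr_natr.
  by apply: ler_sum => j _; apply/ltW/FZ.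
rewrite -ler_pdivlMr // [leRHS]mulrC => ge2.
have := le_trans ge2 (le_trans (ler_norm _) le4); lra.
Qed.

Lemma minimal_calT : minimal T.
Proof.
move=> phi U U0 oU; have [n Un] := forward_dense phi oU U0.
by exists (iter n T phi); split=> //; exists n; left.
Qed.

End Minimality.

(** * Universality *)

Section Universality.
Variable R : realType.
Local Notation H := (calH R).
Local Notation T := (@calT R).

(** A Urysohn function with values 0 at x and 1 at y is within 1/4 of some element of the span. If
    all quasi-eigenfunctions agreed at x and y, so would that element, giving 1 < 1/2. *)
Lemma quasi_eigens_separate (X : topologicalType) (s : X -> X) :
  compact [set: X] -> hausdorff_space X -> quasi_discrete_spectrum R s ->
  forall x y : X, (forall g, quasi_eigens s g -> g x = g y :> circle R) -> x = y.
Proof.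
move=> cX hX /dense_Cont D x y gxy; apply: contrapT => xy.
have cl z : closed [set z : X] by exact/accessible_closed_set1/hausdorff_accessible.
have : uniform_separator [set x] [set y].
  apply: (iffLR (@normal_separatorP R X) (compact_normal hX cX)) => //.
  by rewrite -subset0 => z [-> yz]; apply: xy.
move=> /(@uniform_separatorP _ R)[f [cf _ fx fy]].
have cfC : continuous (fun v => (f v)%:C).
  by apply/continuous_complexP; split=> //; exact: (@cst_continuous X R 0).
have e4 : 0 < 1 / 4 :> R by lra.
have [h [n [c [g [Gg hE]]]] fh] := D _ cfC _ e4.
have hxy : (set_val h : X -> R[i]) x = (set_val h : X -> R[i]) y.
  by rewrite !hE; apply: eq_bigr => i _; rewrite (gxy _ (Gg i)).
have := ltrD (fh x) (fh y).
have -> : f x = 0 by apply: fx; exists x.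
have -> : f y = 1 by apply: fy; exists y.
rewrite hxy; move: (set_val h : X -> R[i]) => h'; move: (h' y) => z lt.
have : `|1%:C - 0%:C| < (1 / 4)%:C + (1 / 4)%:C :> R[i].
  apply: le_lt_trans lt;
    have -> : 1%:C - 0%:C = (1%:C - z) - (0%:C - z) :> R[i] by ring.
  by rewrite [leRHS]addrC; exact: ler_normB.
by rewrite -raddfB -raddfD norm_real_complex ltcR subr0 normr1; lra.
Qed.

Section Factor.
Variables (X : topologicalType) (s : X -> X) (h0 : H) (x0 : X).
Hypothesis cX : compact [set: X].
Hypothesis hX : hausdorff_space X.
Hypothesis cs : continuous s.
Hypothesis qX : quasi_discrete_spectrum R s.

(** Forward times match [forward_dense], which later shows that the orbit closure projects onto all
    of H. *)
Let joint_orbit : set (H * X) := [set p | exists n, p = (iter n T h0, iter n s x0)].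
Let joining : set (H * X) := closure joint_orbit.

Lemma closed_joining : closed joining.
Proof. exact: closed_closure. Qed.

Lemma joining_sub (C : set (H * X)) : closed C ->
  (forall n, C (iter n T h0, iter n s x0)) -> joining `<=` C.
Proof.
move=> cC CO; rewrite (iffLR (closure_id C) cC); apply: closure_subset.
by move=> _ [n ->]; exact: CO.
Qed.

Lemma joining_orbit n : joining (iter n T h0, iter n s x0).
Proof. by apply: subset_closure; exists n. Qed.

Lemma joining_step p : joining p -> joining (T p.1, s p.2).
Proof.
have cTs : continuous (fun p : H * X => (T p.1, s p.2)).
  have c1 : continuous (fun p : H * X => T p.1).
    by move=> q; apply: (@continuous_comp _ _ _ fst T);
      [exact: cvg_fst|exact: continuous_T].
  have c2 : continuous (fun p : H * X => s p.2).
    by move=> q; apply: (@continuous_comp _ _ _ snd s); [exact: cvg_snd|exact: cs].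
  by move=> q; exact: (cvg_pair (c1 q) (c2 q)).
have cl : closed [set p : H * X | joining (T p.1, s p.2)].
  exact: (iffLR (continuous_closedP _) cTs _ closed_joining).
by move=> Jp; apply: (joining_sub cl _ Jp) => n /=; exact: (@joining_orbit n.+1).
Qed.

(* Since e_{k+1,x} o T = e_{k,x} e_{k+1,x}, a character matching the multiplier of
   g lifts to a character with the same multiplier; their ratio is invariant,
   hence constant on the orbit closure. *)
Lemma quasi_eigen_chi_joining m (g : X -> circle R) : quasi_eigen s m g ->
  exists x, forall p, joining p -> g p.2 = chi m x p.1.
Proof.
elim: m g => [|m IHm] g.
  by move=> [c gc]; exists (fun _ => c) => p _; rewrite gc.
move=> [cg [f /IHm[x xP] gf]].
(* Move the coefficients up one place and put [c] in front: every choice of [c] gives a character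
   with multiplier [chi m x]. *)
pose y (c : circle R) k := if k is k'.+1 then x k' else c.
pose r (p : H * X) := (g p.2 * (chi m.+1 (y 1) p.1)^-1)%g.
have rS n : r (iter n T h0, iter n s x0) = r (h0, x0).
  elim: n => // n <-; rewrite /r /= -/(chi m.+1 (y 1%g) (T (iter n T h0))).
  rewrite gf (xP _ (@joining_orbit n)) chi_shift invgM.
  rewrite -/(y 1%g) (_ : (fun k => y 1%g k.+1) = x) //.
  rewrite (circle_mulgC _ (chi m x _)^-1)%g circle_mulACA mulgV mul1g //.
have cr : continuous r.
  apply: continuous_circleM.
    by move=> q; apply: (@continuous_comp _ _ _ snd g); [exact: cvg_snd|exact: cg].
  apply: continuous_circleV => q.
  by apply: (@continuous_comp _ _ _ fst); [exact: cvg_fst|exact: continuous_chi].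
have rc : joining `<=` [set p | r p = cst (r (h0, x0)) p].
  apply: joining_sub => [|n]; last exact: rS.
  apply: closed_equalizer => //; first exact: hausdorff_circle.
  exact: cst_continuous.
have yE c k phi : chi k (y c) phi = (c * chi k (y 1) phi)%g.
  by elim: k => [|k IHk] /=; rewrite ?mulg1 // IHk mulgA.
exists (y (r (h0, x0))) => p Jp; rewrite yE -[r _]/(cst (r (h0, x0)) p) -rc //.
by rewrite /r mulgVK.
Qed.

Lemma joining_functional h x y : joining (h, x) -> joining (h, y) -> x = y.
Proof.
move=> Jx Jy; apply: (quasi_eigens_separate cX hX qX) => g [m _ gm].
have [e eP] := quasi_eigen_chi_joining gm.
by rewrite (eP _ Jx) (eP _ Jy).
Qed.

Lemma compact_joining (C : set X) : closed C ->
  compact (joining `&` [set p | C p.2]).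
Proof.
move=> cC; apply: (@subclosed_compact _ _ [set: H * X]) => //.
  apply: closedI; first exact: closed_joining.
  have csnd : continuous (@snd H X) by move=> q; exact: cvg_snd.
  exact: (iffLR (continuous_closedP _) csnd _ cC).
rewrite -setXTT; apply: compact_setX => //; exact: compact_calH.
Qed.

(** The set is the projection of a compact set. It yields totality when C is the whole space, and
    continuity of the factor map for general C. *)
Lemma closed_joining_fst (C : set X) : closed C ->
  closed [set h | exists2 x, joining (h, x) & C x].
Proof.
move=> cC; apply: compact_closed; first exact: hausdorff_calH.
have := continuous_compact (f := @fst H X) _ (compact_joining cC).
rewrite (_ : _ @` _ = [set h | exists2 x, joining (h, x) & C x]).
  by apply; apply: continuous_subspaceT => q; exact: cvg_fst.
apply/seteqP; split=> [_ [[h x] [/= Jhx Cx] <-]|h [x Jhx Cx]]; first by exists x.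
by exists (h, x).
Qed.

(** The projection of the joining to H is closed and contains a forward orbit, which is dense. *)
Lemma joining_total h : exists x, joining (h, x).
Proof.
have cl := closed_joining_fst closedT.
apply: contrapT => nh.
have [|n] := forward_dense h0 (closed_openC cl); last first.
  by apply; exists (iter n s x0) => //; exact: joining_orbit.
by exists h => -[x Jhx _]; apply: nh; exists x.
Qed.

Lemma factor_map : exists p : H -> X,
  [/\ continuous p, forall h, p (T h) = s (p h) & p h0 = x0].
Proof.
have [p pJ] := boolp.choice joining_total.
have pE h x : joining (h, x) -> p h = x.
  by move=> Jhx; exact: joining_functional (pJ h) Jhx.
exists p; split.
- apply/continuous_closedP => C cC.
  rewrite (_ : p @^-1` C = [set h | exists2 x, joining (h, x) & C x]).
    exact: closed_joining_fst.
  apply/seteqP; split=> [h Ch|h [x /pE <-]] //.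
  by exists (p h).
- by move=> h; apply: pE; exact: (joining_step (pJ h)).
- by apply: pE; exact: (@joining_orbit 0).
Qed.

End Factor.

Lemma universal_calT (X : topologicalType) (s : X -> X) :
  dynamical_system s -> minimal s -> quasi_discrete_spectrum R s ->
  is_factor s T.
Proof.
move=> [[x0 _] cX hX [cs [s' [sK _ _]]]] mX qX.
have [[h0 _] cH hH [_ [T' [_ TK _]]]] := @dynamical_calT R.
have [p [cp pT _]] := factor_map h0 x0 cX hX cs qX.
have pTn n h : p (iter n T h) = iter n s (p h).
  by elim: n => // n IHn; rewrite !iterS pT IHn.
exists p; split=> //; apply: contrapT => ns.
have [x nx] : exists x, ~ exists h, p h = x.
  by apply: contrapT => nex; apply: ns => x; apply: contrapT => nx; apply: nex;
    exists x.
(* The image is compact, hence closed. If it missed a point, minimality of s would put a point of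
   the orbit of p(h0) outside it. *)
have cl : closed (p @` setT).
  apply: compact_closed => //; apply: continuous_compact => //.
  exact: continuous_subspaceT.
have [|y [ny [n yn]]] := mX (p h0) _ _ (closed_openC cl).
  by exists x => -[h _ px]; apply: nx; exists h.
apply: ny; case: yn => [->|yn]; first by exists (iter n T h0).
(* A point on the backward orbit of p(h0) is the image of T^{-n} h0, by injectivity of s^n. *)
exists (iter n T' h0) => //.
have sinj : injective (iter n s).
  by elim: n {yn} => // n IHn a b; rewrite !iterS => /(can_inj sK)/IHn.
apply: sinj; rewrite -pTn yn; congr p.
by elim: n {yn} h0 => // n IHn h0; rewrite iterSr iterS TK IHn.
Qed.

End Universality.

Theorem corollary4p9 (R : realType) :
  [/\ dynamical_system (@calT R),
      minimal (@calT R),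
      quasi_discrete_spectrum R (@calT R) &
      forall (X : topologicalType) (s : X -> X),
        dynamical_system s -> minimal s -> quasi_discrete_spectrum R s ->
        is_factor s (@calT R)].
Proof.
split; [exact: dynamical_calT|exact: minimal_calT|exact: quasi_discrete_calT|].
exact: universal_calT.
Qed.
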